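(* Let $\mathcal U$ be a full rank, primitive upper cluster algebra (of geometric type) with initial seed $t_0$. Let $$M=\frac{P_M(A_{1;t_0},\ldots,A_{n;t_0})}{A_{1;t_0}^{d_1}\cdots A_{n;t_0}^{d_n}}$$ be a monomial in cluster variables of $\mathcal U$ (not necessarily a cluster monomial), where ${\bf d}_M:=(d_1,\ldots,d_n)^{\rm T}$ is the $d$-vector and $P_M$ the numerator polynomial of $M$ with respect to $A_{t_0}$. Then the following statements hold. (i) If $M$ does not contain the initial cluster variable $A_{k;t_0}$ for some $k$, then $(A_{k;t_0}\mid\mid M)_v=0$ and $d_k=(A_{k;t_0}\mid\mid M)_d=(A_{k;t_0}\mid\mid P_M)_v\geq 0$. (ii) If $M$ is a monomial in non-initial cluster variables, then ${\bf d}_M$ and $M$ are uniquely determined by the numerator polynomial $P_M$ (that is, if $M,M'$ are two monomials in non-initial cluster variables with $P_M=P_{M'}$, then ${\bf d}_M={\bf d}_{M'}$ and $M=M'$).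
   Context: Throughout, $\mathbb K$ is a factorial domain (UFD) of characteristic $0$. A semifield $(\mathbb P,\oplus,\cdot)$ is an abelian multiplicative group with a commutative, associative operation $\oplus$ over which multiplication distributes; $\mathbb{KP}$ is its group ring over $\mathbb K$, and $\mathcal F$ is the field of rational functions in $n$ independent variables with coefficients in $\mathbb{KP}$. An integer $n\times n$ matrix $B$ is skew-symmetrizable if $SB$ is skew-symmetric for some integer diagonal matrix $S$ with positive diagonal entries. A (labeled) $\mathscr A$-seed over $\mathbb P$ is a triple $(B,X,A)$ with $B=(b_{ij})$ an $n\times n$ skew-symmetrizable integer matrix, $X=(X_1,\ldots,X_n)\in\mathbb P^n$, and $A=(A_1,\ldots,A_n)$ a free generating set of $\mathcal F$ over $\mathbb{KP}$. Its $k$-th exchange binomial is $P_k=\frac{X_k}{1\oplus X_k}\prod_{b_{jk}>0}A_j^{b_{jk}}+\frac{1}{1\oplus X_k}\prod_{b_{jk}<0}A_j^{-b_{jk}}$. The mutation $\mu_k(B,X,A)=(B',X',A')$ is: $b'_{ij}=-b_{ij}$ if $i=k$ or $j=k$, else $b'_{ij}=b_{ij}+\mathrm{sgn}(b_{ik})\max(b_{ik}b_{kj},0)$; $X'_k=X_k^{-1}$ and $X'_i=X_iX_k^{\max(b_{ki},0)}(1\oplus X_k)^{-b_{ki}}$ for $i\ne k$; $A'_i=A_i$ for $i\neq k$ and $A'_k=A_k^{-1}P_k$. Let $\mathbb T_n$ be the $n$-regular tree with edges labeled $1,\ldots,n$ so that edges at each vertex have distinct labels. An $\mathscr A$-seed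 pattern assigns to each vertex $t$ a seed $(B_t,X_t,A_t)$, $B_t=(b^t_{ij})$, $X_t=(X_{1;t},\ldots,X_{n;t})$, $A_t=(A_{1;t},\ldots,A_{n;t})$, such that seeds at vertices joined by an edge labeled $k$ are related by $\mu_k$. A vertex and its seed are denoted by the same letter; one vertex $t_0$ is chosen as initial, and the variables in $A_{t_0}$ are the initial cluster variables. The upper cluster algebra is $\mathcal U=\bigcap_{t}\mathcal L(t)$ with $\mathcal L(t)=\mathbb{KP}[A_{1;t}^{\pm1},\ldots,A_{n;t}^{\pm1}]$. The $A_{k;t}$ are the cluster variables (they lie in $\mathcal U$). A monomial in cluster variables is a finite product $\prod_i M_i$ of cluster variables $M_i$ (not necessarily from a common cluster); it does not contain $A_{k;t_0}$ if all $M_i\neq A_{k;t_0}$. Standing assumption: no exchange binomial of $\mathcal U$ is invertible in $\mathbb{KP}$. Geometric type: $\mathbb P=\mathrm{Trop}(Z_1,\ldots,Z_m)$, the free abelian group on $Z_1,\ldots,Z_m$ with $\prod Z_i^{a_i}\oplus\prod Z_i^{b_i}=\prod Z_i^{\min(a_i,b_i)}$. Writing $X_{k;t}=\prod_i Z_i^{c_{ik}^t}$, $C_t=(c_{ij}^t)_{m\times n}$, the extended exchange matrix is the $(n+m)\times n$ matrix $\widetilde B_t=\begin{pmatrix}B_t\\C_t\end{pmatrix}$. $\mathcal U$ is full rank if it is of geometric type and $\widetilde B_{t_0}$ has full rank $n$; it is primitive if it is of geometric type and each column of $\widetilde B_{t_0}$ is primitive (the gcd of its entries is $1$). Valuation pairing: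 for a cluster variable $A_{k;t}$ and $M\in\mathcal U$, $(A_{k;t}\mid\mid M)_v:=\max\{s\in\mathbb N\mid M/A_{k;t}^s\in\mathcal U\}\in\mathbb N\cup\{\infty\}$. $d$-vector: any non-zero $M\in\mathcal L(t_0)$ is uniquely $M=P_M(A_{1;t_0},\ldots,A_{n;t_0})/(A_{1;t_0}^{d_1}\cdots A_{n;t_0}^{d_n})$ with $d_i\in\mathbb Z$ and $P_M\in\mathbb{KP}[A_{1;t_0},\ldots,A_{n;t_0}]$ not divisible by any $A_{j;t_0}$; $(d_1,\ldots,d_n)^{\rm T}$ is the $d$-vector and $P_M$ the numerator polynomial of $M$ with respect to $A_{t_0}$. For $0\ne M\in\mathcal U$, the $d$-compatibility degree $(A_{k;t_0}\mid\mid M)_d$ is the $k$-th component of the $d$-vector of $M$ with respect to $A_{t_0}$. *)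

(* Defs.v *)
From HB Require Import structures.
From mathcomp Require Import all_boot all_order all_algebra.
From mathcomp Require Import mpoly.
From mathcomp Require Import boolp classical_sets.

Set Implicit Arguments.
Unset Strict Implicit.
Unset Printing Implicit Defensive.

Import Order.TTheory GRing.Theory Num.Theory.
Local Open Scope ring_scope.

Section FactorialDomain.
Variable K : idomainType.

Definition irreducible_elt (x : K) : Prop :=
  [/\ x != 0, x \isn't a GRing.unit &
      forall a b, x = a * b -> a \is a GRing.unit \/ b \is a GRing.unit].

Definition associates (x y : K) : Prop :=
  exists2 u, u \is a GRing.unit & y = u * x.

Definition factorial_domain : Prop :=
  (forall x : K, x != 0 -> x \isn't a GRing.unit ->
     exists2 s : seq K,
       (forall y, y \in s -> irreducible_elt y) & x = \prod_(y <- s) y)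
  /\
  (forall s s' : seq K,
     (forall y, y \in s -> irreducible_elt y) ->
     (forall y, y \in s' -> irreducible_elt y) ->
     \prod_(y <- s) y = \prod_(y <- s') y ->
     exists r : seq K,
       [/\ perm_eq r s', size r = size s &
           forall i, (i < size s)%N -> associates s`_i r`_i]).

End FactorialDomain.

(* The tropical semifield Trop(Z_1, ..., Z_m): the element \prod_i Z_i ^ e_i
   is represented by its exponent vector e.  The semifield multiplication is
   thus the addition of vectors, its unit is 0, the a-th power of e is
   e *~ a, and the semifield addition is the entrywise minimum. *)
Notation Trop m := 'cV[int]_m.

Definition trop_add (m : nat) (x y : Trop m) : Trop m :=
  \col_i Num.min (x i 0) (y i 0).

(* The group ring KP of P = Trop(Z_1, ..., Z_m) over K, i.e., the ring of
   Laurent polynomials in Z_1, ..., Z_m, realised inside the fraction field of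
   K[Z_1, ..., Z_m] as the set of the p / Z^e. *)
Section GroupRing.
Variables (K : idomainType) (m : nat).

Local Notation Q := {fraction {mpoly K[m]}}.

Definition is_laurent (x : Q) : Prop :=
  exists (e : 'X_{1..m}) (p : {mpoly K[m]}), x * tofrac 'X_[e] = tofrac p.

Definition laurent : {pred Q} := fun x => `[< is_laurent x >].

Lemma laurentP x : reflect (is_laurent x) (x \in laurent).
Proof. exact: asboolP. Qed.

Lemma laurent_subring : subring_closed laurent.
Proof.
split.
- by apply/laurentP; exists 0%MM, 1; rewrite mpolyX0 mul1r.
- move=> x y /laurentP[e [p xp]] /laurentP[f [q yq]]; apply/laurentP.
  exists (e + f)%MM, (p * 'X_[f] - q * 'X_[e]).
  by rewrite mpolyXD rmorphB !rmorphM /= -xp -yq mulrBl -!mulrA; congr (_ - _);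
    rewrite [X in _ * X = _]mulrC.
- move=> x y /laurentP[e [p xp]] /laurentP[f [q yq]]; apply/laurentP.
  exists (e + f)%MM, (p * q).
  by rewrite mpolyXD !rmorphM /= -xp -yq mulrACA.
Qed.

HB.instance Definition _ :=
  GRing.isSubringClosed.Build Q laurent laurent_subring.

Record group_ring : Type :=
  GroupRing { group_ring_val : Q; _ : group_ring_val \in laurent }.

HB.instance Definition _ := [isSub for group_ring_val].
HB.instance Definition _ := [Choice of group_ring by <:].
HB.instance Definition _ := [SubChoice_isSubComNzRing of group_ring by <:].

Definition group_ring_unit : pred group_ring :=
  fun x => (val x != 0) && ((val x)^-1 \in laurent).

Definition group_ring_inv (x : group_ring) : group_ring :=
  if val x != 0 then insubd x (val x)^-1 else x.

Lemma group_ring_mulVx :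
  {in group_ring_unit, left_inverse 1 group_ring_inv *%R}.
Proof.
move=> x /andP[x0 xV]; apply: val_inj.
by rewrite /group_ring_inv x0 /= insubdK //= mulVf.
Qed.

Lemma group_ring_unitPl (x y : group_ring) : y * x = 1 -> group_ring_unit x.
Proof.
move=> /(congr1 val) /= yx1.
have x0 : val x != 0.
  by apply: contra_eq_neq yx1 => ->; rewrite mulr0 eq_sym oner_neq0.
apply/andP; split=> //.
suff -> : (val x)^-1 = val y by exact: valP.
by apply: (mulIf x0); rewrite mulVf // yx1.
Qed.

Lemma group_ring_inv_out :
  {in [predC group_ring_unit], group_ring_inv =1 id}.
Proof.
move=> x; rewrite inE negb_and negbK /group_ring_inv => /orP[->//|xV].
by case: ifP => // _; rewrite /insubd insubN.
Qed.

HB.instance Definition _ := GRing.ComNzRing_hasMulInverse.Build group_ring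
  group_ring_mulVx group_ring_unitPl group_ring_inv_out.

Lemma group_ring_integral (x y : group_ring) :
  x * y = 0 -> (x == 0) || (y == 0).
Proof.
by move=> /(congr1 val) /= /eqP; rewrite mulf_eq0.
Qed.

HB.instance Definition _ :=
  GRing.ComUnitRing_isIntegral.Build group_ring group_ring_integral.

Lemma Zvar_subproof (i : 'I_m) : tofrac 'X_i \in laurent.
Proof. by apply/laurentP; exists 0%MM, 'X_i; rewrite mpolyX0 mulr1. Qed.

Definition Zvar (i : 'I_m) : group_ring := GroupRing (Zvar_subproof i).

Lemma Zvar_unit i : Zvar i \is a GRing.unit.
Proof.
have X0 : tofrac 'X_i != 0 :> Q by rewrite tofrac_eq0 -msupp_eq0 msuppX.
apply/andP; split=> //=.
by apply/laurentP; exists U_(i)%MM, 1; rewrite mulVf ?rmorph1.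
Qed.

Definition Zmon (e : Trop m) : group_ring := \prod_i Zvar i ^ e i 0.

End GroupRing.

(* The n-regular tree T_n: vertices are the words in the labels without two
   equal consecutive letters, and an edge labeled k joins w and k :: w. *)
Definition Tn (n : nat) : Type :=
  {w : seq 'I_n | sorted (fun i j => i != j) w}.

Definition Tn_edge (n : nat) (k : 'I_n) (t t' : Tn n) : Prop :=
  sval t' = k :: sval t \/ sval t = k :: sval t'.

Section ClusterAlgebra.
Variables (K : idomainType) (m n : nat).

Local Notation KP := (group_ring K m).

Definition ambient : fieldType := {fraction {mpoly KP[n]}}.

Local Notation F := ambient.

Definition scalar (c : KP) : F := tofrac (c%:MP : {mpoly KP[n]}).

Definition peval (A : 'I_n -> F) (p : {mpoly KP[n]}) : F := mmap scalar A p.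

Definition free_generating (A : 'I_n -> F) : Prop :=
  (forall p, peval A p = 0 -> p = 0) /\
  (forall f : F, exists p q, peval A q != 0 /\ f = peval A p / peval A q).

Definition skew_symmetrizable (B : 'M[int]_n) : Prop :=
  exists s : 'rV[int]_n, (forall i, 0 < s 0 i) /\
    (diag_mx s *m B)^T = - (diag_mx s *m B).

Record labeled_triple : Type := Triple {
  exB : 'M[int]_n;
  exX : {ffun 'I_n -> Trop m};
  exA : {ffun 'I_n -> F} }.

Definition is_seed (s : labeled_triple) : Prop :=
  skew_symmetrizable (exB s) /\ free_generating (exA s).

Definition exchange_binomial (k : 'I_n) (s : labeled_triple) : F :=
  let B := exB s in let A := exA s in
  let x := exX s k in let y := trop_add 0 x in
  scalar (Zmon K (x - y)) * \prod_(j | 0 < B j k) A j ^ B j k +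
  scalar (Zmon K (- y)) * \prod_(j | B j k < 0) A j ^ (- B j k).

Definition mutB (k : 'I_n) (B : 'M[int]_n) : 'M[int]_n :=
  \matrix_(i, j)
    if (i == k) || (j == k) then - B i j
    else B i j + Num.sg (B i k) * Num.max (B i k * B k j) 0.

Definition mutX (k : 'I_n) (B : 'M[int]_n) (X : {ffun 'I_n -> Trop m}) :
    {ffun 'I_n -> Trop m} :=
  [ffun i => if i == k then - X k
             else X i + X k *~ Num.max (B k i) 0
                  + trop_add 0 (X k) *~ (- B k i)].

Definition mutA (k : 'I_n) (s : labeled_triple) : {ffun 'I_n -> F} :=
  [ffun i => if i == k then (exA s k)^-1 * exchange_binomial k s
             else exA s i].

Definition mutation (k : 'I_n) (s : labeled_triple) : labeled_triple :=
  Triple (mutB k (exB s)) (mutX k (exB s) (exX s)) (mutA k s).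

Definition seed_pattern (Sigma : Tn n -> labeled_triple) : Prop :=
  (forall t, is_seed (Sigma t)) /\
  (forall k t t', Tn_edge k t t' -> Sigma t' = mutation k (Sigma t)).

Definition extended_exchange_matrix (s : labeled_triple) : 'M[int]_(n + m, n) :=
  col_mx (exB s) (\matrix_(i, k) exX s k i 0).

Definition full_rank (s : labeled_triple) : Prop :=
  \rank (map_mx intr (extended_exchange_matrix s) : 'M[rat]_(n + m, n)) = n.

Definition primitive (s : labeled_triple) : Prop :=
  forall k, \big[gcdn/0%N]_i `|extended_exchange_matrix s i k|%N = 1%N.

(* The ring KP[A_1^{+-1}, ..., A_n^{+-1}]. *)
Definition laurent_ring (A : 'I_n -> F) (f : F) : Prop :=
  exists (p : {mpoly KP[n]}) (e : 'X_{1..n}),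
    f = peval A p / \prod_i A i ^+ e i.

Section Expansion.
Variable A : 'I_n -> F.

Definition is_expansion (M : F) (dP : 'cV[int]_n * {mpoly KP[n]}) : Prop :=
  M = peval A dP.2 / \prod_i A i ^ dP.1 i 0 /\
  (forall j, ~ exists q, dP.2 = q * 'X_j).

(* The unique expansion when M is a non-zero element of laurent_ring A, a
   default value otherwise. *)
Definition expansion (M : F) : 'cV[int]_n * {mpoly KP[n]} :=
  xget (0, 0) (is_expansion M).

Definition d_vector (M : F) : 'cV[int]_n := (expansion M).1.
Definition numerator (M : F) : {mpoly KP[n]} := (expansion M).2.

Definition d_compatibility (k : 'I_n) (M : F) : int := d_vector M k 0.

End Expansion.

Section Pattern.
Variable Sigma : Tn n -> labeled_triple.

Definition upper_cluster_algebra (f : F) : Prop :=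
  forall t, laurent_ring (exA (Sigma t)) f.

Definition cluster_variable (f : F) : Prop :=
  exists t k, f = exA (Sigma t) k.

Definition no_invertible_exchange_binomial : Prop :=
  forall t k, ~ exists2 u : KP,
    u \is a GRing.unit & exchange_binomial k (Sigma t) = scalar u.

(* max {s | M / a ^ s \in U}, with values in the extended natural numbers:
   None stands for infinity. *)
Definition valuation_pairing (a M : F) : option nat :=
  xget None [set v : option nat | exists s : nat,
    [/\ v = Some s, upper_cluster_algebra (M / a ^+ s) &
        forall s' : nat, upper_cluster_algebra (M / a ^+ s') -> (s' <= s)%N]].

End Pattern.

End ClusterAlgebra.

(* Main.v *)
Require Import Defs.
From HB Require Import structures.
From mathcomp Require Import all_boot all_order all_algebra.
From mathcomp Require Import mpoly.
From mathcomp Require Import boolp classical_sets.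
(* [classical_sets] shadows lemmas on finite sets, e.g. [subsetP]. *)
From mathcomp Require Import fintype finset.
From mathcomp Require Import ring zify.

Set Implicit Arguments.
Unset Strict Implicit.
Unset Printing Implicit Defensive.

Import Order.TTheory GRing.Theory Num.Theory.
Local Open Scope ring_scope.

(* For a seed t, put together the n cluster variables and the m frozen
   variables into y_t, and let b_1, ..., b_n be the columns of the extended
   exchange matrix. In geometric type the exchange binomial P_k is
   y^[b_k]_+ + y^[-b_k]_+, and the coefficients mutate as the lower rows of the
   extended matrix do. Full rank is invariant under mutation and makes the
   exchange binomials of a seed pairwise coprime; as shown by Berenstein, Fomin
   and Zelevinsky, the intersection U(t) of the Laurent rings of t and of its
   neighbours is then the same for all t, and it contains all cluster variables.
   This reduces membership in the upper cluster algebra to the n + 1 Laurent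
   rings around t0: dividing by A_k can only fail in the Laurent ring of the
   neighbour t1 in direction k, where A_k is a unit times P_k. As b_k is
   primitive, P_k is a prime element there, so if A_k divides a product of
   cluster variables it divides one of them, say z = A_{i;t}.
   Then A_k and z / A_k are units of the Laurent ring of t, i.e., monomials in
   y_t; exponents of cluster variables are nonnegative since exchange binomials
   are not units, hence A_k = u Z^c z. Evaluating at 0/1 points the subtraction-
   free expression of z in the variables of t0 yields c = 0, and u = 1 since
   the Laurent phenomenon holds over the integers. So A_k does not divide M when
   M does not contain A_k. The valuation of P_M = M A^d is then d_k, which gives
   (i), and (ii) follows since d is a function of P_M. *)

(** * Laurent polynomials in one variable over a subring of a field *)

Section LaurentExtension.
Variable F : fieldType.

(** Membership of [f] in S[x, x^-1], given by a numerator [p] and the denominator x^N, so that it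
    can be tested on the coefficients of [p]. *)
Definition laurent_ext (S : {pred F}) (x f : F) : Prop :=
  exists N p, p \is a polyOver S /\ f * x ^+ N = p.[x].

Definition transcendental (S : {pred F}) (x : F) : Prop :=
  forall p, p \is a polyOver S -> p.[x] = 0 -> p = 0.

Definition divides_in (S : {pred F}) (d a : F) : Prop :=
  exists2 c, c \in S & a = c * d.

Variables (S : subringClosed F) (x : F).
Implicit Types (f g P : F) (p q : {poly F}).

Lemma horner_in_subring (T : subringClosed F) p z :
  p \is a polyOver S -> {subset S <= T} -> z \in T -> p.[z] \in T.
Proof.
move=> /polyOverP pS ST zT; rewrite horner_coef.
by apply: rpred_sum => i _; apply: rpredM; [exact: ST | exact: rpredX].
Qed.

Lemma transcendental_inj p q : transcendental S x ->
  p \is a polyOver S -> q \is a polyOver S -> p.[x] = q.[x] -> p = q.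
Proof.
move=> xS pS qS pq; apply/eqP; rewrite -subr_eq0; apply/eqP/xS.
  exact: rpredB.
by rewrite hornerD hornerN pq subrr.
Qed.

Lemma transcendental_neq0 : transcendental S x -> x != 0.
Proof.
move=> xS; apply/eqP => x0; suff /eqP : ('X : {poly F}) = 0 by rewrite polyX_eq0.
by apply: xS; [exact: polyOverX | rewrite hornerX].
Qed.

Lemma laurent_ext_sub f : f \in S -> laurent_ext S x f.
Proof.
by move=> fS; exists 0%N, f%:P; rewrite polyOverC fS hornerC mulr1.
Qed.

Lemma laurent_ext_gen : laurent_ext S x x.
Proof. by exists 0%N, 'X; rewrite polyOverX hornerX mulr1. Qed.

Lemma laurent_ext_inv : x != 0 -> laurent_ext S x x^-1.
Proof.
move=> x0; exists 1%N, 1; rewrite rpred1 expr1 mulVf//.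
by rewrite -(polyC1) hornerC.
Qed.

Lemma laurent_extD f g :
  laurent_ext S x f -> laurent_ext S x g -> laurent_ext S x (f + g).
Proof.
move=> [M [p [pS fp]]] [N [q [qS gq]]].
exists (M + N)%N, (p * 'X^N + q * 'X^M); split.
  by rewrite rpredD// rpredM// rpredX// polyOverX.
by rewrite !(hornerD, hornerM, hornerXn) -fp -gq exprD; ring.
Qed.

Lemma laurent_extM f g :
  laurent_ext S x f -> laurent_ext S x g -> laurent_ext S x (f * g).
Proof.
move=> [M [p [pS fp]]] [N [q [qS gq]]].
exists (M + N)%N, (p * q); split; first exact: rpredM.
by rewrite hornerM -fp -gq exprD; ring.
Qed.

(* Membership in S[x, x^-1] and in S[x', x'^-1] is compared on the coefficients
   of a numerator; here x' stands for P / x. *)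
Lemma laurent_ext_flip f P p N : transcendental S x -> P \in S -> P != 0 ->
    p \is a polyOver S -> f * x ^+ N = p.[x] -> laurent_ext S (x^-1 * P) f ->
  forall i, (i < N)%N -> divides_in S (P ^+ (N - i)) p`_i.
Proof.
move=> xS PS P0 pS fp [M [q [qS fq]]] i iN.
have x0 := transcendental_neq0 xS.
(* [D] is so large that no subtraction of exponents below truncates; [r] is x^(N+D) q(P/x), written
   as a polynomial in x. *)
pose D := (size q + M)%N.
pose r := \sum_(j < size q) (q`_j * P ^+ j) *: 'X^(N + D - j) : {poly F}.
have qr : forall j, (j < size q)%N ->
    x ^+ (N + D) * (x^-1 * P) ^+ j = P ^+ j * x ^+ (N + D - j).
  move=> j jq; rewrite exprMn exprVn expfB_cond; first by ring.
  by rewrite (negPf x0) add0n /D; lia.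
have xD : x ^+ D = x ^+ M * x ^+ (D - M) by rewrite -exprD subnKC ?leq_addl.
have E : (P ^+ M *: p) * 'X^(D - M) = r.
  apply: (transcendental_inj xS).
  - by rewrite rpredM ?polyOverZ ?rpredX ?polyOverX.
  - apply: rpred_sum => j _; rewrite polyOverZ ?rpredX ?polyOverX//.
    by rewrite rpredM ?rpredX//; exact/polyOverP.
  rewrite hornerM hornerZ hornerXn -fp /r horner_sum.
  transitivity (x ^+ (N + D) * q.[x^-1 * P]).
    rewrite -fq exprMn exprVn [x ^+ (N + D)]exprD xD.
    have xM0 : x ^+ M != 0 by rewrite expf_neq0.
    by field.
  rewrite horner_coef mulr_sumr; apply: eq_bigr => j _.
  rewrite hornerZ hornerXn -mulrA -qr; last exact: ltn_ord.
  by ring.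
(* Coefficient of X^(i+D-M): P^M p_i on the left, and q_j P^j with j = N-i+M on the right. *)
move/(congr1 (fun s : {poly F} => s`_(i + (D - M)))): E.
rewrite coefMXn ltnNge leq_addl /= addnK coefZ /r coef_sum => E.
exists q`_(N - i + M); first exact/polyOverP.
have PM0 : P ^+ M != 0 by rewrite expf_neq0.
apply: (mulfI PM0); rewrite E.
have [lt_q|ge_q] := ltnP (N - i + M) (size q).
  rewrite (bigD1 (Ordinal lt_q)) //= coefZ coefXn.
  have -> : (i + (D - M) == N + D - (N - i + M))%N by apply/eqP; rewrite /D; lia.
  rewrite big1 ?addr0 => [|j].
    by rewrite mulr1 exprD; ring.
  rewrite -val_eqE /= coefZ coefXn => jn.
  suff -> : (i + (D - M) == N + D - j)%N = false by rewrite mulr0.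
  by move: jn (ltn_ord j); rewrite /D; lia.
rewrite nth_default // mul0r mulr0 big1// => j _.
rewrite coefZ coefXn.
suff -> : (i + (D - M) == N + D - j)%N = false by rewrite mulr0.
by move: (ltn_ord j); rewrite /D; lia.
Qed.

(** Converse of [laurent_ext_flip]: the terms of degree i >= N form [q], and for i < N the factor
    P^(N-i) turns c P^(N-i) x^(i-N) into c x'^(N-i), where x' = P/x. *)
Lemma laurent_ext_unflip f P p N : x != 0 -> P \in S ->
    p \is a polyOver S -> f * x ^+ N = p.[x] ->
    (forall i, (i < N)%N -> divides_in S (P ^+ (N - i)) p`_i) ->
  exists q r, [/\ q \is a polyOver S, r \is a polyOver S,
    f = q.[x] + r.[x^-1 * P],
    forall i, q`_i = p`_(i + N) &
    forall i, (i < N)%N -> p`_i = r`_(N - i) * P ^+ (N - i)].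
Proof.
move=> x0 PS pS fp dvd.
have /choice[c cP] : forall i : 'I_N, exists c, c \in S /\ p`_i = c * P ^+ (N - i).
  by move=> i; have [c cS ci] := dvd i (ltn_ord i); exists c.
pose q := drop_poly N p.
pose r := \sum_(i < N) c i *: 'X^(N - i) : {poly F}.
have xN0 : x ^+ N != 0 by rewrite expf_neq0.
exists q, r; split.
- by apply/polyOverP => i; rewrite coef_drop_poly; exact/polyOverP.
- apply: rpred_sum => i _; rewrite polyOverZ ?rpredX ?polyOverX//.
  by have [] := cP i.
- apply: (mulIf xN0); rewrite fp -{1}(poly_take_drop N p) hornerD hornerM hornerXn.
  rewrite mulrDl addrC; congr (_ + _).
  rewrite /take_poly horner_poly /r horner_sum mulr_suml.
  apply: eq_bigr => i _; have [_ ->] := cP i.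
  rewrite hornerZ hornerXn exprMn exprVn.
  have -> : x ^+ N = x ^+ (N - i) * x ^+ i.
    by rewrite -exprD subnK// ltnW.
  have xNi0 : x ^+ (N - i) != 0 by rewrite expf_neq0.
  by field.
- by move=> i; rewrite coef_drop_poly.
move=> i iN; have [_ /= ->] := cP (Ordinal iN); congr (_ * _).
rewrite /r coef_sum (bigD1 (Ordinal iN)) //= coefZ coefXn eqxx mulr1 big1 ?addr0//.
move=> j; rewrite -val_eqE /= => ji; rewrite coefZ coefXn.
suff -> : (N - i == N - j)%N = false by rewrite mulr0.
by move: ji (ltn_ord j); lia.
Qed.

(** For x x' = P, the intersection of S[x, x^-1] and S[x', x'^-1] is S[x, x'], hence lies in every
    ring that contains S, x and x'. *)
Lemma laurent_ext_flip_mem (T : subringClosed F) f P :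
    transcendental S x -> P \in S -> P != 0 ->
    laurent_ext S x f -> laurent_ext S (x^-1 * P) f ->
    {subset S <= T} -> x \in T -> x^-1 * P \in T ->
  f \in T.
Proof.
move=> xS PS P0 [N [p [pS fp]]] fx' ST xT x'T.
have dvd := laurent_ext_flip xS PS P0 pS fp fx'.
have [q [r [qS rS -> _ _]]] :=
  laurent_ext_unflip (transcendental_neq0 xS) PS pS fp dvd.
by rewrite rpredD//; apply: horner_in_subring ST _.
Qed.

(** Transcendence over S extends to coefficients in the fraction field of S, by multiplying with a
    common denominator [D]. *)
Lemma transcendental_frac p : transcendental S x ->
    (forall i, exists d, [/\ d \in S, d != 0 & d * p`_i \in S]) ->
  p.[x] = 0 -> p = 0.
Proof.
move=> xS /choice[d dP] px.
pose D := \prod_(i < size p) d i.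
have D0 : D != 0 by apply/prodf_neq0 => i _; have [] := dP i.
suff : D *: p = 0 by move/eqP; rewrite scaler_eq0 (negPf D0) => /eqP.
apply: xS; last by rewrite hornerZ px mulr0.
apply/polyOverP => i; rewrite coefZ.
have [ip|pi] := ltnP i (size p); last by rewrite nth_default// mulr0 rpred0.
rewrite /D (bigD1 (Ordinal ip))//= mulrAC rpredM//; first by have [] := dP i.
by apply: rpred_prod => j _; have [] := dP j.
Qed.

End LaurentExtension.

(** * Laurent polynomials over algebraically independent elements *)

Section LaurentRing.
Variables (K : idomainType) (F : fieldType) (iota : {rmorphism K -> F}).
Variables (N : nat).
Implicit Types (y : 'I_N -> F) (J : {set 'I_N}) (e : 'I_N -> int).

(** Generated inductively, so that a subring contains it as soon as it contains the generators; [J]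
    is the set of variables in use, which later inductions remove one by one. *)
Inductive laurent_over y J : F -> Prop :=
  | laurent_const c : laurent_over y J (iota c)
  | laurent_var j : j \in J -> laurent_over y J (y j)
  | laurent_varV j : j \in J -> laurent_over y J (y j)^-1
  | laurent_add f g :
      laurent_over y J f -> laurent_over y J g -> laurent_over y J (f + g)
  | laurent_mul f g :
      laurent_over y J f -> laurent_over y J g -> laurent_over y J (f * g).

Definition lau y J : {pred F} := fun f => `[< laurent_over y J f >].

Lemma lauP y J f : reflect (laurent_over y J f) (f \in lau y J).
Proof. exact: asboolP. Qed.

Lemma lau_subring y J : subring_closed (lau y J).
Proof.
split.
- by apply/lauP; rewrite -(rmorph1 iota); exact: laurent_const.
- move=> f g /lauP fJ /lauP gJ; apply/lauP/laurent_add => //.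
  by rewrite -mulN1r -(rmorphN1 iota); apply: laurent_mul => //; exact: laurent_const.
- by move=> f g /lauP fJ /lauP gJ; apply/lauP/laurent_mul.
Qed.

HB.instance Definition _ y J :=
  GRing.isSubringClosed.Build F (lau y J) (@lau_subring y J).

Lemma lau_iota y J c : iota c \in lau y J.
Proof. exact/lauP/laurent_const. Qed.

Lemma lau_var y J j : j \in J -> y j \in lau y J.
Proof. by move=> ?; exact/lauP/laurent_var. Qed.

Lemma lau_varV y J j : j \in J -> (y j)^-1 \in lau y J.
Proof. by move=> ?; exact/lauP/laurent_varV. Qed.

Lemma lau_min y J (T : subringClosed F) :
    (forall c, iota c \in T) -> (forall j, j \in J -> y j \in T) ->
    (forall j, j \in J -> (y j)^-1 \in T) -> {subset lau y J <= T}.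
Proof.
move=> cT yT yVT f /lauP; elim=> //.
- by move=> g h _ gT _ hT; rewrite rpredD.
- by move=> g h _ gT _ hT; rewrite rpredM.
Qed.

Lemma lau_sub y J J' : J \subset J' -> {subset lau y J <= lau y J'}.
Proof.
move=> /subsetP JJ'; apply: lau_min => [c|j /JJ'|j /JJ'].
- exact: lau_iota.
- exact: lau_var.
- exact: lau_varV.
Qed.

Lemma lau_eq y y' J : {in J, y =1 y'} -> {subset lau y J <= lau y' J}.
Proof.
move=> yy'; apply: lau_min => [c|j jJ|j jJ].
- exact: lau_iota.
- by rewrite yy'//; exact: lau_var.
- by rewrite yy'//; exact: lau_varV.
Qed.

(** Singles out the variable [y j]; the coefficients involve only the other variables, so the
    results on S[x, x^-1] apply. *)
Lemma lau_peel y J j f : y j != 0 -> f \in lau y J ->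
  laurent_ext (lau y (J :\ j)) (y j) f.
Proof.
move=> yj0 /lauP; elim.
- by move=> c; apply/laurent_ext_sub/lau_iota.
- move=> i iJ; have [->|ij] := eqVneq i j; first exact: laurent_ext_gen.
  by apply/laurent_ext_sub/lau_var; rewrite !inE ij.
- move=> i iJ; have [->|ij] := eqVneq i j; first exact: laurent_ext_inv.
  by apply/laurent_ext_sub/lau_varV; rewrite !inE ij.
- by move=> g h _ + _; exact: laurent_extD.
- by move=> g h _ + _; exact: laurent_extM.
Qed.

Definition alg_independent y :=
  forall p : {mpoly K[N]}, mmap iota y p = 0 -> p = 0.

Section Independence.
Variable y : 'I_N -> F.
Hypothesis y_indep : alg_independent y.

Local Notation ev := (mmap iota y).

Lemma alg_independent_inj : injective ev.
Proof.
by move=> p q pq; apply/eqP; rewrite -subr_eq0; apply/eqP/y_indep;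
  rewrite mmapB pq subrr.
Qed.

Lemma evU i : ev 'X_i = y i.
Proof. by rewrite mmapX mmap1U. Qed.

Lemma alg_independent_neq0 i : y i != 0.
Proof.
by rewrite -evU; apply/eqP => /y_indep /eqP; rewrite -msupp_eq0 msuppX.
Qed.

(** Reads a polynomial as one in X_j over the other variables. The coefficients stay in [{mpoly
    K[N]}], so that [split_var j q = q%:P] expresses that [q] does not contain X_j. *)
Definition split_var (j : 'I_N) : {mpoly K[N]} -> {poly {mpoly K[N]}} :=
  mmap (polyC \o @mpolyC N K) (fun i => if i == j then 'X else ('X_i)%:P).

HB.instance Definition _ j := GRing.RMorphism.on (split_var j).

Lemma split_varU j i : i != j -> split_var j 'X_i = ('X_i)%:P.
Proof. by move=> /negPf ij; rewrite /split_var mmapX mmap1U ij. Qed.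

Lemma split_var_id j : split_var j 'X_j = 'X.
Proof. by rewrite /split_var mmapX mmap1U eqxx. Qed.

Definition free_of (j : 'I_N) : {pred F} := fun f =>
  `[< exists q, split_var j q = q%:P /\ ev q = f >].

Lemma free_of_subring j : subring_closed (free_of j).
Proof.
split.
- by apply/asboolP; exists 1; rewrite !rmorph1.
- move=> _ _ /asboolP[p [pj <-]] /asboolP[q [qj <-]]; apply/asboolP.
  by exists (p - q); rewrite !rmorphB /= pj qj.
- move=> _ _ /asboolP[p [pj <-]] /asboolP[q [qj <-]]; apply/asboolP.
  by exists (p * q); rewrite !rmorphM /= pj qj.
Qed.

HB.instance Definition _ j :=
  GRing.isSubringClosed.Build F (free_of j) (@free_of_subring j).

Lemma free_of_var i j : i != j -> y i \in free_of j.
Proof. by move=> ij; apply/asboolP; exists 'X_i; rewrite split_varU// evU. Qed.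

Lemma free_of_iota c j : iota c \in free_of j.
Proof.
apply/asboolP; exists c%:MP; split; last exact: mmapC.
by rewrite /split_var mmapC.
Qed.

Lemma lau_free_of J j f : j \notin J -> f \in lau y J ->
  exists d, [/\ d \in free_of j, d != 0 & d * f \in free_of j].
Proof.
move=> jJ /lauP; elim.
- by move=> c; exists 1; rewrite rpred1 oner_neq0 mul1r free_of_iota.
- move=> i iJ; exists 1; rewrite rpred1 oner_neq0 mul1r free_of_var//.
  by apply: contraNneq jJ => <-.
- move=> i iJ; exists (y i).
  rewrite alg_independent_neq0 mulfV ?alg_independent_neq0// rpred1.
  by rewrite free_of_var//; apply: contraNneq jJ => <-.
- move=> g h _ [c [cj c0 gj]] _ [d [dj d0 hj]]; exists (c * d).
  split; [exact: rpredM | exact: mulf_neq0 |].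
  by rewrite mulrDr rpredD//; [rewrite mulrAC|rewrite -mulrA]; exact: rpredM.
- move=> g h _ [c [cj c0 gj]] _ [d [dj d0 hj]]; exists (c * d).
  by split; [exact: rpredM | exact: mulf_neq0 | rewrite mulrACA; exact: rpredM].
Qed.

(** A relation in [y j] with coefficients free of j lifts to the polynomial [P.['X_j]], which is
    zero by independence; [split_var j] recovers [P] from it. *)
Lemma free_of_transcendental j : transcendental (free_of j) (y j).
Proof.
move=> p pj px.
have /choice[q qP] : forall i, exists q, split_var j q = q%:P /\ ev q = p`_i.
  by move=> i; apply/asboolP; exact: (polyOverP pj).
pose P := \poly_(i < size p) q i.
have evP : ev P.['X_j] = p.[y j].
  rewrite /P horner_poly horner_coef rmorph_sum; apply: eq_bigr => i _ /=.
  by rewrite rmorphM rmorphXn /= evU; have [_ ->] := qP i.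
have : split_var j P.['X_j] = P.
  rewrite {1}/P horner_poly rmorph_sum /= /P poly_def; apply: eq_bigr => i _.
  rewrite rmorphM rmorphXn /= split_var_id; have [-> _] := qP i.
  by rewrite mul_polyC.
have /y_indep -> : ev P.['X_j] = 0 by rewrite evP.
rewrite rmorph0 => P0; apply/polyP => i; rewrite coef0.
have [ip|ip] := ltnP i (size p); last by rewrite nth_default.
have [_ <-] := qP i; suff -> : q i = P`_i by rewrite -P0 coef0 rmorph0.
by rewrite coef_poly ip.
Qed.

Lemma lau_transcendental J j : j \notin J -> transcendental (lau y J) (y j).
Proof.
move=> jJ p pJ; apply: (transcendental_frac (@free_of_transcendental j)) => i.
by apply: lau_free_of jJ _; exact/polyOverP.
Qed.

Lemma lau_transcendental_setD1 J j : transcendental (lau y (J :\ j)) (y j).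
Proof. by apply: lau_transcendental; rewrite !inE eqxx. Qed.

Definition mono y (e : 'I_N -> int) : F := \prod_i y i ^ e i.

Lemma eq_mono z e e' : e =1 e' -> mono z e = mono z e'.
Proof. by move=> ee'; apply: eq_bigr => i _; rewrite ee'. Qed.

Lemma mono_eq z z' e : (forall i, e i != 0 -> z i = z' i) -> mono z e = mono z' e.
Proof.
move=> zz'; apply: eq_bigr => i _.
by have [->|/zz' ->] := eqVneq (e i) 0; rewrite ?expr0z.
Qed.

Lemma monoD z e e' : (forall i, z i != 0) ->
  mono z (fun i => e i + e' i) = mono z e * mono z e'.
Proof. by move=> z0; rewrite -big_split; apply: eq_bigr => i _; rewrite expfzDr. Qed.

Lemma mono0 z : mono z (fun=> 0) = 1.
Proof. by rewrite /mono big1// => i _; rewrite expr0z. Qed.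

Lemma mono_exp z e (k : int) : mono z (fun i => e i * k) = mono z e ^ k.
Proof.
rewrite /mono (big_morph (fun f : F => f ^ k) (id1 := 1) (op1 := *%R)) => [|f g|].
- by apply: eq_bigr => i _; rewrite -exprz_exp.
- exact: expfzMl.
- exact: exp1rz.
Qed.

Lemma monoN z e : mono z (fun i => - e i) = (mono z e)^-1.
Proof.
by rewrite -exprN1 -mono_exp; apply: eq_mono => i; rewrite mulrN1.
Qed.

Lemma mono_neq0 z e : (forall i, z i != 0) -> mono z e != 0.
Proof. by move=> z0; apply/prodf_neq0 => i _; rewrite expfz_neq0. Qed.

Lemma mono_split j z e :
  mono z e = z j ^ e j * mono z (fun i => if i == j then 0 else e i).
Proof.
rewrite /mono (bigD1 j)//= [in RHS](bigD1 j)//= eqxx expr0z mul1r.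
by congr (_ * _); apply: eq_bigr => i /negPf ->.
Qed.

Lemma mono_delta z j : mono z (fun i => (i == j)%:Z) = z j.
Proof.
rewrite (mono_split j) eqxx expr1z -[RHS]mulr1 -(mono0 z).
by congr (_ * _); apply: eq_mono => i; case: eqP.
Qed.

Lemma expfz_lau z J j (k : int) : j \in J -> z j ^ k \in lau z J.
Proof.
move=> jJ; case: k => k; first by rewrite rpredX// lau_var.
by rewrite NegzE -exprnN -exprVn rpredX// lau_varV.
Qed.

Lemma mono_lau z J e : (forall i, e i != 0 -> i \in J) -> mono z e \in lau z J.
Proof.
move=> eJ; apply: rpred_prod => i _.
have [->|/eJ iJ] := eqVneq (e i) 0; first by rewrite expr0z rpred1.
exact: expfz_lau.
Qed.

Lemma mono_ev (m : 'X_{1..N}) : ev 'X_[m] = mono y (fun i => (m i)%:Z).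
Proof. by rewrite mmapX. Qed.

Lemma mono_inj u u' e e' : u != 0 ->
  iota u * mono y e = iota u' * mono y e' -> u = u' /\ e =1 e'.
Proof.
move=> u0 E; have y0 := alg_independent_neq0.
(* Shifting both exponent vectors by [d] makes them nonnegative, so that the two monomials can be
   compared as polynomials. *)
pose d i := (`|e i| + `|e' i|)%N.
pose m := [multinom absz (e i + (d i)%:Z)%R | i < N].
pose m' := [multinom absz (e' i + (d i)%:Z)%R | i < N].
have mE i : (m i)%:Z = e i + (d i)%:Z by rewrite mnmE /d; lia.
have m'E i : (m' i)%:Z = e' i + (d i)%:Z by rewrite mnmE /d; lia.
have : ev (u *: 'X_[m]) = ev (u' *: 'X_[m']).
  rewrite !mmapZ !mono_ev (eq_mono _ mE) (eq_mono _ m'E) !monoD//.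
  by rewrite !mulrA E.
move=> /alg_independent_inj /(congr1 (mcoeff m)).
rewrite !mcoeffZ !mcoeffX eqxx mulr1.
have [mm'|_] := eqVneq m' m => uu'; last by move: u0; rewrite uu' mulr0 eqxx.
by split=> [|i]; rewrite ?uu' ?mulr1//; apply: (addIr (d i)%:Z); rewrite -mE -m'E mm'.
Qed.

Lemma mul_eqXn (p q : {poly F}) n : p * q = 'X^n -> exists c i, p = c *: 'X^i.
Proof.
move=> pq; have : p %| ('X - 0%:P) ^+ n.
  by rewrite polyC0 subr0 -pq dvdp_mulr.
move=> /dvdp_exp_XsubCP[i _]; rewrite polyC0 subr0 => /eqpf_eq[c _ ->].
by exists c, i.
Qed.

Lemma iota_inj : injective iota.
Proof.
move=> u v uv; have /(congr1 (mcoeff 0%MM)) : u%:MP = v%:MP :> {mpoly K[N]};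
  last by rewrite !mpolyCK.
apply: alg_independent_inj.
by rewrite !mmapC.
Qed.

Lemma lau_set0 f : f \in lau y set0 -> exists c, f = iota c.
Proof.
move=> /lauP; elim => [c|j|j|_ _ _ [c ->] _ [d ->]|_ _ _ [c ->] _ [d ->]].
- by exists c.
- by rewrite inE.
- by rewrite inE.
- by exists (c + d); rewrite rmorphD.
- by exists (c * d); rewrite rmorphM.
Qed.

(** The numerators of f and f^-1 multiply to a power of X, so both are monomials c X^i and d X^k
    with c d = 1. *)
Lemma lau_unit_peel J j f : f \in lau y J -> f^-1 \in lau y J -> f != 0 ->
  exists g k, [/\ f = g * y j ^ (k : int), g \in lau y (J :\ j),
    g^-1 \in lau y (J :\ j) & g != 0].
Proof.
move=> fJ fVJ f0; have y0 := alg_independent_neq0 j.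
have [a [p [pS fp]]] := lau_peel y0 fJ.
have [b [q [qS fq]]] := lau_peel y0 fVJ.
have xS := @lau_transcendental_setD1 J j.
have pq : p * q = 'X^(a + b).
  apply: (transcendental_inj xS); rewrite ?rpredM ?rpredX ?polyOverX//.
  by rewrite hornerM hornerXn -fp -fq exprD mulrACA mulfV// mul1r.
have [c [i pE]] := mul_eqXn pq.
have [d [k qE]] : exists c i, q = c *: 'X^i by apply: (@mul_eqXn _ p (a + b)); rewrite mulrC.
have cS : c \in lau y (J :\ j).
  by have /polyOverP /(_ i) := pS; rewrite pE coefZ coefXn eqxx mulr1.
have dS : d \in lau y (J :\ j).
  by have /polyOverP /(_ k) := qS; rewrite qE coefZ coefXn eqxx mulr1.
have cd : c * d = 1.
  move/(congr1 (fun p : {poly F} => p.[1])): pq.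
  by rewrite pE qE hornerM !hornerZ !hornerXn !expr1n !mulr1.
have c0 : c != 0 by apply: contra_eq_neq cd => ->; rewrite mul0r eq_sym oner_neq0.
exists c, (i%:Z - a%:Z); split => //.
  apply: (mulIf (expf_neq0 a y0)); rewrite fp pE hornerZ hornerXn -mulrA; congr (_ * _).
  by rewrite [y j ^+ a]exprnP -expfzDr// subrK.
by have -> : c^-1 = d by rewrite -[LHS]mulr1 -cd mulKf.
Qed.

(** Peeling off one variable at a time ends with a constant whose inverse is a constant too; [v] is
    the inverse of [u] in K. *)
Lemma lau_unit J f : f \in lau y J -> f^-1 \in lau y J -> f != 0 ->
  exists u v e, [/\ u * v = 1, f = iota u * mono y e & forall i, e i != 0 -> i \in J].
Proof.
elim: {J}#|J| {-2}J (erefl #|J|) f => [|n IHn] J cardJ f fJ fVJ f0.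
  have J0 : J = set0 by apply/eqP; rewrite -cards_eq0 cardJ.
  move: fJ fVJ; rewrite J0 => /lau_set0[u fu] /lau_set0[v fv].
  exists u, v, (fun=> 0); rewrite mono0 mulr1 fu; split=> //.
  by apply: iota_inj; rewrite rmorphM -fu -fv rmorph1 mulfV.
have /set0Pn[j jJ] : J != set0 by rewrite -cards_eq0 cardJ.
have [g [k [fE gS gVS g0]]] := lau_unit_peel j fJ fVJ f0.
have [|u [v [e [uv gE eJ]]]] := IHn _ _ g gS gVS g0.
  by have := cardsD1 j J; rewrite jJ cardJ add1n => -[].
exists u, v, (fun i => e i + (i == j)%:Z * k); split=> //.
  rewrite monoD; last exact: alg_independent_neq0.
  by rewrite mono_exp mono_delta fE gE mulrA.
move=> i; have [->//|ij] := eqVneq i j; rewrite mul0r addr0 => /eJ.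
by rewrite !inE => /andP[].
Qed.

End Independence.

End LaurentRing.

(** * Localization and binomials *)

Section Localization.
Variables (F : fieldType) (W : subringClosed F) (w : F).
Hypothesis wW : w \in W.

Definition localize : {pred F} := fun f => `[< exists s, w ^+ s * f \in W >].

Lemma localizeP f : reflect (exists s, w ^+ s * f \in W) (f \in localize).
Proof. exact: asboolP. Qed.

Lemma localize_subring : subring_closed localize.
Proof.
split.
- by apply/localizeP; exists 0%N; rewrite mul1r rpred1.
- move=> f g /localizeP[s sW] /localizeP[t tW]; apply/localizeP; exists (s + t)%N.
  rewrite exprD mulrBr -mulrA [w ^+ t * f]mulrC mulrA -[_ * _ * g]mulrA.
  by rewrite rpredB// rpredM// rpredX.
- move=> f g /localizeP[s sW] /localizeP[t tW]; apply/localizeP; exists (s + t)%N.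
  by rewrite exprD mulrACA rpredM.
Qed.

Definition localization : subringClosed F :=
  HB.pack localize (GRing.isSubringClosed.Build F localize localize_subring).

Lemma localize_sub f : f \in W -> f \in localization.
Proof. by move=> fW; apply/localizeP; exists 0%N; rewrite mul1r. Qed.

Lemma localizeV : w != 0 -> w^-1 \in localization.
Proof.
by move=> w0; apply/localizeP; exists 1%N; rewrite expr1 mulfV// rpred1.
Qed.

(* If [v] is invertible modulo [w], then localizing at both [v] and [w] adds
   nothing that is not already seen by one of them. *)
Lemma localize_comaximal (v v' z f : F) :
    v \in W -> v' \in W -> z \in W -> v * v' = 1 + w * z ->
    (exists s, v ^+ s * f \in W) -> f \in localization -> f \in W.
Proof.
move=> vW v'W zW vv' [s sW] /localizeP[t tW].
(* As v v' is 1 modulo w, so is its power: (v v')^s = 1 + w u. *)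
pose u := z * \sum_(i < s) (1 + w * z) ^+ i.
have uW : u \in W.
  rewrite rpredM// rpred_sum// => i _.
  by rewrite rpredX// rpredD ?rpred1// rpredM.
have us : (v * v') ^+ s = 1 + w * u.
  rewrite vv' /u mulrA; have := subrX1 (1 + w * z) s.
  by rewrite [1 + w * z - 1]addrAC subrr add0r => <-; ring.
(* The geometric series [G] gives 1 = (v v')^s G + (-w u)^t. After multiplication by f, the first
   term is cleared by v^s and the second by w^t. *)
pose a := - (w * u); pose G := \sum_(i < t) a ^+ i.
have GW : G \in W.
  by rewrite rpred_sum// => i _; rewrite rpredX// rpredN rpredM.
have aG : (1 + w * u) * G = 1 - a ^+ t.
  have := subrX1 a t; rewrite -/G => at1.
  have -> : 1 + w * u = - (a - 1) by rewrite /a; ring.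
  by rewrite mulNr -at1 opprB.
have -> : f = (v' ^+ s * G) * (v ^+ s * f) + (- u) ^+ t * (w ^+ t * f).
  have -> : v' ^+ s * G * (v ^+ s * f) = (1 + w * u) * G * f.
    by rewrite -us exprMn; ring.
  by rewrite aG mulrA -exprMn /a mulNr [u * w]mulrC; ring.
by rewrite rpredD// rpredM// ?rpredM// rpredX// rpredN.
Qed.

End Localization.

Section Binomial.
Variables (F : fieldType) (N : nat).
Implicit Types (y : 'I_N -> F) (b : 'I_N -> int).

Definition binomial y b : F :=
  mono y (fun i => Num.max (b i) 0) + mono y (fun i => Num.max (- b i) 0).

Lemma binomialN y b : binomial y (fun i => - b i) = binomial y b.
Proof.
rewrite /binomial addrC; congr (_ + _).
by apply: eq_mono => i; rewrite opprK.
Qed.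

Lemma eq_binomial y b b' : b =1 b' -> binomial y b = binomial y b'.
Proof.
by move=> bb'; congr (_ + _); apply: eq_mono => i; rewrite bb'.
Qed.

Lemma binomial_eq y y' b :
  (forall i, b i != 0 -> y i = y' i) -> binomial y b = binomial y' b.
Proof.
move=> yy'; congr (_ + _); apply: mono_eq => i b0; apply: yy'.
  by apply: contraNneq b0 => ->.
by apply: contraNneq b0 => ->; rewrite oppr0.
Qed.

Lemma binomial_factor y b : (forall i, y i != 0) ->
  binomial y b = mono y (fun i => Num.max (- b i) 0) * (1 + mono y b).
Proof.
move=> y0; rewrite mulrDr mulr1 -monoD// addrC; congr (_ + _).
by apply: eq_mono => i; lia.
Qed.

Lemma binomial_factorN y b : (forall i, y i != 0) ->
  binomial y b =
  mono y (fun i => Num.max (b i) 0) * (1 + mono y (fun i => - b i)).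
Proof.
move=> y0; rewrite -binomialN binomial_factor//; congr (_ * _).
by apply: eq_mono => i; rewrite opprK.
Qed.

Lemma mono_ge0_mem (T : subringClosed F) y b :
    (forall i, b i != 0 -> y i \in T) -> (forall i, b i < 0 -> (y i)^-1 \in T) ->
  mono y b \in T.
Proof.
move=> yT yVT; apply: rpred_prod => i _.
move: (yT i) (yVT i); case: (b i) => k.
  by have [->|k0 /(_ k0) yi _] := eqVneq k 0; [rewrite rpred1 | rewrite rpredX].
by move=> _ yVi; rewrite NegzE -exprnN -exprVn rpredX// yVi//; lia.
Qed.

Lemma binomial_mem (T : subringClosed F) y b :
  (forall i, b i != 0 -> y i \in T) -> binomial y b \in T.
Proof.
by move=> yT; apply: rpredD; apply: mono_ge0_mem => i bi; try apply: yT; lia.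
Qed.

End Binomial.

(** * Mutation *)

Lemma max_mut (a b : int) : 0 < b -> Num.sg a * Num.max (a * b) 0 = Num.max a 0 * b.
Proof.
move=> b0; have [a0|a0|->] := ltrgtP a 0;
  by rewrite ?sgr0 ?(gtr0_sg a0) ?(ltr0_sg a0); nia.
Qed.

Section Mutation.
Variables (F : fieldType) (N n : nat) (mu : 'I_n -> 'I_N).
Hypothesis mu_inj : injective mu.
Implicit Types (y : 'I_N -> F) (B : 'I_N -> 'I_n -> int).

Definition mutate_matrix k B : 'I_N -> 'I_n -> int := fun i j =>
  if (i == mu k) || (j == k) then - B i j
  else B i j + Num.sg (B i k) * Num.max (B i k * B (mu k) j) 0.

Definition mutate_vars k B y : 'I_N -> F := fun i =>
  if i == mu k then (y i)^-1 * binomial y (B^~ k) else y i.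

(** Changing the sign of B commutes with matrix mutation and does not affect the mutation of
    variables; this reduces b_kl < 0 to b_kl > 0. *)
Definition opp_matrix B : 'I_N -> 'I_n -> int := fun i j => - B i j.

Lemma mutate_matrixN k B i j :
  mutate_matrix k (opp_matrix B) i j = - mutate_matrix k B i j.
Proof.
rewrite /mutate_matrix /opp_matrix; case: ifP => _; first by [].
by rewrite mulrNN sgrN mulNr opprD.
Qed.

Lemma mutate_varsN k B y : mutate_vars k (opp_matrix B) y =1 mutate_vars k B y.
Proof.
by move=> i; rewrite /mutate_vars /opp_matrix; case: ifP => // _; rewrite binomialN.
Qed.

Lemma mutate_vars_neq k B y i : i != mu k -> mutate_vars k B y i = y i.
Proof. by rewrite /mutate_vars => /negPf ->. Qed.

Lemma mutate_vars_eq k B y :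
  mutate_vars k B y (mu k) = (y (mu k))^-1 * binomial y (B^~ k).
Proof. by rewrite /mutate_vars eqxx. Qed.

Lemma exchange_relation k B y : y (mu k) != 0 ->
  y (mu k) * mutate_vars k B y (mu k) = binomial y (B^~ k).
Proof. by move=> y0; rewrite mutate_vars_eq mulrA mulfV// mul1r. Qed.

(* The mutation rule of the hatted variables of Fomin and Zelevinsky, when
   [0 < b_kl] *)
Lemma mono_mutate k l B y : (forall i, y i != 0) ->
    mutate_vars k B y (mu k) != 0 -> k != l -> B (mu k) k = 0 -> 0 < B (mu k) l ->
  mono (mutate_vars k B y) (mutate_matrix k B ^~ l) =
  mono y (B^~ l) * (1 + mono y (fun i => - B i k)) ^ (- B (mu k) l).
Proof.
move=> y0 x0 kl Bkk Bkl.
have E : forall i, i != mu k ->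
    mutate_matrix k B i l = B i l + Num.max (B i k) 0 * B (mu k) l.
  move=> i /negPf ik; rewrite /mutate_matrix ik /= eq_sym (negPf kl).
  by rewrite max_mut.
rewrite (mono_split (mu k)) [in RHS](mono_split (mu k) y (B^~ l)).
have -> : mutate_matrix k B (mu k) l = - B (mu k) l by rewrite /mutate_matrix eqxx.
set Bl' := fun i => if i == mu k then 0 else B i l.
have -> : mono (mutate_vars k B y)
    (fun i => if i == mu k then 0 else mutate_matrix k B i l) =
    mono y (fun i => Bl' i + Num.max (B i k) 0 * B (mu k) l).
  transitivity (mono y (fun i => if i == mu k then 0 else mutate_matrix k B i l)).
    apply: mono_eq => i; case: ifP => [_ /eqP //|/negbT ik _].
    exact: mutate_vars_neq.
  apply: eq_mono => i; rewrite /Bl'; case: ifP => [/eqP ->|/negbT ik].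
    by rewrite Bkk maxxx mul0r addr0.
  exact: E.
rewrite monoD// mono_exp mutate_vars_eq binomial_factorN//.
have P0 : 1 + mono y (fun i => - B i k) != 0.
  by apply: contraNneq x0 => P0; rewrite mutate_vars_eq binomial_factorN// P0 !mulr0.
have c0 : mono y (fun i => Num.max (B i k) 0) != 0 by exact: mono_neq0.
rewrite !expfzMl exprz_inv opprK.
case: (B (mu k) l) Bkl => // b _; rewrite -!exprnN -!exprnP.
have cb : mono y (fun i => Num.max (B i k) 0) ^+ b != 0 by rewrite expf_neq0.
by move: (P0) => /(expf_neq0 b) P0b; field; rewrite cb P0b.
Qed.

End Mutation.

Lemma laurent_ext_subring (F : fieldType) (S S' : subringClosed F) (x x' f : F) :
  {subset S <= S'} -> x = x' -> laurent_ext S x f -> laurent_ext S' x' f.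
Proof.
move=> SS' <- [M [p [/polyOverP pS fp]]]; exists M, p; split=> //.
by apply/polyOverP => i; exact/SS'/pS.
Qed.

(** * Two consecutive mutations with positive exchange entry *)

Section RankTwo.
Variables (K : idomainType) (F : fieldType) (iota : {rmorphism K -> F}).
Variables (N n : nat) (mu : 'I_n -> 'I_N).
Hypothesis mu_inj : injective mu.
Implicit Types (y : 'I_N -> F) (B : 'I_N -> 'I_n -> int).
Local Notation lau := (lau iota).
Local Notation mutate_matrix := (mutate_matrix mu).
Local Notation mutate_vars := (mutate_vars mu).

(** [f] is a polynomial in [y (mu k)] and its exchange partner over the Laurent ring of the other
    variables, and W[w^-1] contains all these generators. *)
Lemma lau_flip_localize (W : subringClosed F) (w : F) (wW : w \in W) y B k f :
    alg_independent iota y -> B (mu k) k = 0 -> mutate_vars k B y (mu k) != 0 ->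
    f \in lau y setT -> f \in lau (mutate_vars k B y) setT ->
    (forall c, iota c \in W) ->
    (forall i, y i \in W) -> mutate_vars k B y (mu k) \in W ->
    (forall i, i != mu k -> y i != w -> (y i)^-1 \in W) -> w != 0 ->
  f \in localization wW.
Proof.
move=> yi Bkk x0 fy fy1 iW yW x'W yVW w0.
have y0 := alg_independent_neq0 yi.
have sub : forall g, g \in W -> g \in localization wW by exact: localize_sub.
have yS := @lau_transcendental_setD1 _ _ _ _ _ yi setT (mu k).
apply: (laurent_ext_flip_mem (P := binomial y (B^~ k)) yS).
- apply: binomial_mem => i Bi; apply: lau_var; rewrite !inE andbT.
  by apply: contraNneq Bi => ->; rewrite Bkk.
- by apply: contraNneq x0 => P0; rewrite mutate_vars_eq P0 mulr0.
- exact: lau_peel.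
- have := lau_peel x0 fy1; rewrite mutate_vars_eq; apply: laurent_ext_subring => //.
  by apply: lau_eq => i; rewrite !inE andbT; exact: mutate_vars_neq.
- apply: lau_min => [c|i _|i]; [exact/sub/iW | exact/sub/yW |].
  rewrite !inE andbT => ik.
  have [->|yiw] := eqVneq (y i) w; first exact: localizeV.
  exact/sub/yVW.
- exact/sub/yW.
- by rewrite -mutate_vars_eq; exact: sub.
Qed.



(* The new variable x2' of direct mutation at l is a polynomial in the one
   obtained after mutation at k, and c^-1 x1' inverts x1 modulo x2, which allows
   to clear the denominators of f separately. *)
Lemma rank_two_pos y B k l f :
    alg_independent iota y -> k != l -> B (mu k) k = 0 -> B (mu l) l = 0 ->
    0 < B (mu k) l -> B (mu l) k < 0 ->
    let y1 := mutate_vars k B y in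
    let y2 := mutate_vars l (mutate_matrix k B) y1 in
    let yl := mutate_vars l B y in
    (forall i, y1 i != 0) -> (forall i, y2 i != 0) -> yl (mu l) != 0 ->
    f \in lau y setT -> f \in lau y1 setT -> f \in lau yl setT ->
  f \in lau y2 setT.
Proof.
move=> yi kl Bkk Bll Bkl Blk y1 y2 yl y10 y20 yl0 fy fy1 fyl.
have y0 := alg_independent_neq0 yi.
have mkl : mu k != mu l by rewrite (inj_eq mu_inj).
have B1ll : mutate_matrix k B (mu l) l = 0.
  rewrite /mutate_matrix Bll [_ == mu k]eq_sym (negPf mkl) [l == k]eq_sym (negPf kl) /=.
  by rewrite add0r max_mut//; lia.
have y2E i : i != mu l -> y2 i = y1 i by exact: mutate_vars_neq.
have y1E i : i != mu k -> y1 i = y i by exact: mutate_vars_neq.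
pose W := lau y2 setT.
have iW c : iota c \in W by exact: lau_iota.
have y2W i : y2 i \in W by exact: lau_var.
have y2VW i : (y2 i)^-1 \in W by exact: lau_varV.
have y1W' i : i != mu l -> y1 i \in W by move=> il; rewrite -y2E.
have y1VW i : i != mu l -> (y1 i)^-1 \in W by move=> il; rewrite -y2E.
have ylW : y (mu l) \in W.
  rewrite -y1E 1?eq_sym//.
  have -> : y1 (mu l) = binomial y1 (mutate_matrix k B ^~ l) * (y2 (mu l))^-1.
    by rewrite -(exchange_relation (mutate_matrix k B) (y10 (mu l))) mulfK.
  rewrite rpredM//; apply: binomial_mem => i Bi; apply: y1W'.
  by apply: contraNneq Bi => ->; rewrite B1ll.
have yW' i : i != mu k -> y i \in W.
  by have [->|il ik] := eqVneq i (mu l); rewrite // -y1E// y1W'.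
have yVW i : i != mu k -> i != mu l -> (y i)^-1 \in W.
  by move=> ik il; rewrite -y1E// y1VW.
have ykW : y (mu k) \in W.
  have -> : y (mu k) = binomial y (B^~ k) * (y1 (mu k))^-1.
    by rewrite -(exchange_relation B (y0 (mu k))) mulfK.
  rewrite rpredM ?y1VW//; apply: binomial_mem => i Bi; apply: yW'.
  by apply: contraNneq Bi => ->; rewrite Bkk.
have yW i : y i \in W by have [->|/yW'] := eqVneq i (mu k).
(* Since b_lk < 0, the monomial y^(-b_k) has a factor [y (mu l)]; [z] is the cofactor. *)
pose z := mono y (fun i => - B i k - (i == mu l)%:Z).
have zW : z \in W.
  by apply: mono_ge0_mem => // i; have [->|il] := eqVneq i (mu l); last
    have [->|ik] := eqVneq i (mu k); rewrite ?Bkk => ?; try lia; exact: yVW.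
have Yk : mono y (fun i => - B i k) = y (mu l) * z.
  rewrite -[X in X * _](mono_delta y) -monoD//; apply: eq_mono => i; lia.
pose c := mono y (fun i => Num.max (B i k) 0).
have c0 : c != 0 by exact: mono_neq0.
have cVW : c^-1 \in W.
  rewrite -monoN; apply: mono_ge0_mem => // i Bi; apply: yVW.
    by apply: contraTneq Bi => ->; rewrite Bkk.
  by apply: contraTneq Bi => ->; lia.
have comax : y (mu k) * (c^-1 * y1 (mu k)) = 1 + y (mu l) * z.
  rewrite mulrCA exchange_relation// binomial_factorN// -/c Yk.
  by rewrite mulrA mulVf// mul1r.
have ylWl : yl (mu l) \in W.
  pose r := mono y (fun i => Num.max (- B i l) 0).
  pose r1 := mono y1 (fun i => Num.max (- mutate_matrix k B i l) 0).
  have rW : r \in W by apply: mono_ge0_mem => // i; lia.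
  have r10 : r1 != 0 by exact: mono_neq0.
  have r1VW : r1^-1 \in W.
    rewrite -monoN; apply: mono_ge0_mem => i Bi; [apply: y1W'|apply: y1VW];
      by apply: contraTneq Bi => ->; rewrite B1ll.
  have r0 : r != 0 by exact: mono_neq0.
  have El : y (mu l) * yl (mu l) = r * (1 + mono y (B^~ l)).
    by rewrite exchange_relation// binomial_factor.
  have E1 : y (mu l) * y2 (mu l) =
      r1 * (1 + mono y (B^~ l) * (1 + y (mu l) * z) ^ (- B (mu k) l)).
    rewrite -[y (mu l) in LHS]y1E 1?eq_sym// exchange_relation//.
    by rewrite binomial_factor// mono_mutate//  Yk.
  have u0 : 1 + y (mu l) * z != 0.
    rewrite -comax !mulf_neq0// ?invr_neq0//.
  case: (B (mu k) l) Bkl E1 => // b _; rewrite -exprnN.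
  set u := 1 + y (mu l) * z in u0 *; set yh := mono y _ => E1.
  have uW : u \in W by rewrite rpredD ?rpred1// rpredM.
  (* [v] is the quotient of u^b - 1 by [y (mu l)]. *)
  pose v := z * \sum_(i < b) u ^+ i.
  have vW : v \in W.
    by rewrite rpredM// rpred_sum// => i _; rewrite rpredX.
  have ub : u ^+ b = 1 + y (mu l) * v.
    have := subrX1 u b; rewrite {2}/u [1 + _ - 1]addrAC subrr add0r /v => ub.
    by rewrite mulrA -ub addrC subrK.
  have ub0 : u ^+ b != 0 by exact: expf_neq0.
  (* With H = [yh], the products of [y (mu l)] with [yl (mu l)] and [y2 (mu l)] are r (1 + H) and r1
     (1 + H / u^b), and u^b (1 + H / u^b) - (u^b - 1) = 1 + H. *)
  suff -> : yl (mu l) = r * (u ^+ b * y2 (mu l) / r1 - v).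
    by rewrite rpredM// rpredB// !rpredM// rpredX.
  apply: (mulfI (y0 (mu l))); rewrite El mulrCA; congr (_ * _).
  have -> : y (mu l) * (u ^+ b * y2 (mu l) / r1 - v) =
      u ^+ b * (y (mu l) * y2 (mu l)) / r1 - y (mu l) * v by ring.
  rewrite E1; have -> : y (mu l) * v = u ^+ b - 1 by rewrite ub; ring.
  have id U R H : U != 0 -> R != 0 -> 1 + H = U * (R * (1 + H / U)) / R - (U - 1) :> F.
    by move=> U0 R0; field; rewrite R0 U0.
  exact: id.
(* The exchange in direction k leaves only powers of [y (mu l)] as denominators of f, the one in
   direction l only powers of [y (mu k)]. *)
have fl : f \in localization ylW.
  apply: (@lau_flip_localize W _ ylW y B k f) => //; first exact: y1W'.
  by move=> i ik iw; apply: yVW => //; apply: contraNneq iw => ->.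
have fk : f \in localization ykW.
  apply: (@lau_flip_localize W _ ykW y B l f) => //.
  by move=> i il iw; apply: yVW => //; apply: contraNneq iw => ->.
apply: (localize_comaximal (w := y (mu l)) ykW _ zW comax) => //.
- by rewrite rpredM// y1W'.
- exact/localizeP.
Qed.

End RankTwo.

(** * Coprimality of binomials *)

(** Coprimality, in the form that P can be cancelled modulo Q, passes to powers of P by iteration
    and then to powers of Q by splitting off one factor Q at a time. *)
Lemma divides_in_exp (F : fieldType) (S : subringClosed F) (P Q : F) :
    P \in S -> Q \in S -> Q != 0 ->
    (forall a, a \in S -> divides_in S Q (P * a) -> divides_in S Q a) ->
  forall i j a, a \in S -> divides_in S (Q ^+ j) (P ^+ i * a) ->
  divides_in S (Q ^+ j) a.
Proof.
move=> PS QS Q0 coprime i.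
have coprimeX a : a \in S -> divides_in S Q (P ^+ i * a) -> divides_in S Q a.
  move=> aS; elim: i => [|i IHi]; first by rewrite mul1r.
  by rewrite exprS -mulrA => /coprime QPa; apply/IHi/QPa; rewrite rpredM ?rpredX.
elim=> [|j IHj] a aS; first by exists a; rewrite // mulr1.
move=> [c cS Pa].
have [|a' a'S aE] := coprimeX a aS.
  exists (c * Q ^+ j); last by rewrite Pa exprSr mulrA.
  by rewrite rpredM// rpredX.
have [|c' c'S a'E] := IHj a' a'S.
  by exists c => //; apply: (mulIf Q0); rewrite -mulrA -aE Pa exprSr mulrA.
by exists c'; rewrite // aE a'E exprSr mulrA.
Qed.

Lemma expfz_N1 (F : fieldType) (k : int) : (-1 : F) ^ k = 1 \/ (-1 : F) ^ k = -1.
Proof.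
have nat_case (i : nat) : (-1 : F) ^+ i = 1 \/ (-1 : F) ^+ i = -1.
  by rewrite -signr_odd; case: odd; [right|left].
case: k => k; first exact: nat_case.
rewrite NegzE -exprnN; have [->|->] := nat_case k.+1;
  rewrite ?invr1 ?invrN1; do [by left | by right].
Qed.

(** Y is -1 modulo 1 + Y; negative powers are powers of Y^-1, and 1 + Y^-1 is 1 + Y up to the unit
    Y. *)
Lemma expfz_modN1 (F : fieldType) (T : subringClosed F) (Y : F) (k : int) :
    Y \in T -> Y^-1 \in T -> Y != 0 ->
  exists2 t, t \in T & Y ^ k = (-1) ^ k + t * (1 + Y).
Proof.
move=> YT YVT Y0.
have nat_case (Z : F) (i : nat) : Z \in T ->
    exists2 t, t \in T & Z ^+ i = (-1) ^+ i + t * (1 + Z).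
  move=> ZT; exists (\sum_(j < i) Z ^+ (i.-1 - j) * (-1) ^+ j).
    by rewrite rpred_sum// => j _; rewrite rpredM// rpredX// rpredN1.
  have := subrXX Z (-1) i; rewrite opprK [1 + Z]addrC [_ * (Z + 1)]mulrC => <-.
  by rewrite addrC subrK.
case: k => k; first exact: nat_case.
have [t tT E] := nat_case Y^-1 k.+1 YVT.
exists (t * Y^-1); first exact: rpredM.
rewrite NegzE -!exprnN -!exprVn E invrN1 -mulrA; congr (_ + _ * _).
by rewrite mulrDr mulr1 mulVf// addrC.
Qed.

Section Coprime.
Variables (K : idomainType) (F : fieldType) (iota : {rmorphism K -> F}).
Variables (N : nat) (y : 'I_N -> F).
Hypothesis y_indep : alg_independent iota y.
Local Notation lau := (lau iota).
Implicit Types (v w : 'I_N -> int).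

Definition independent_columns v w :=
  forall a b : int, (forall i, v i * a + w i * b = 0) -> a = 0 /\ b = 0.

Let y0 := alg_independent_neq0 y_indep.

Lemma mono_lauV (J : {set _}) v : (forall i, v i != 0 -> i \in J) -> (mono y v)^-1 \in lau y J.
Proof. by move=> vJ; rewrite -monoN; apply: mono_lau => i; rewrite oppr_eq0 => /vJ. Qed.

Lemma divides_in_binomial (J : {set _}) v a : (forall i, v i != 0 -> i \in J) ->
  divides_in (lau y J) (binomial y v) a <-> divides_in (lau y J) (1 + mono y v) a.
Proof.
move=> vJ; pose e i := Num.max (- v i) 0.
have eJ i : e i != 0 -> i \in J by move=> ei; apply: vJ; move: ei; rewrite /e; lia.
have m0 : mono y e != 0 by exact: mono_neq0.
rewrite binomial_factor//; split=> -[c cJ ->].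
  by exists (c * mono y e); rewrite ?mulrA// rpredM// mono_lau.
exists (c * (mono y e)^-1); first by rewrite rpredM// mono_lauV.
by rewrite -mulrA mulKf.
Qed.

(* Modulo [1 + y^w] and [1 + y^v] the monomials y^w and y^v become -1, so that
   the monomial y^z with z = w_j v - v_j w, free of [j], becomes a sign. *)
Lemma eliminate (J : {set _}) v w j a : (forall i, v i != 0 -> i \in J) ->
    (forall i, w i != 0 -> i \in J) -> independent_columns v w ->
    w j != 0 -> a \in lau y J ->
    divides_in (lau y J) (1 + mono y w) ((1 + mono y v) * a) ->
  exists E, [/\ E \in lau y (J :\ j), E != 0 &
    divides_in (lau y J) (1 + mono y w) (a * E)].
Proof.
move=> vJ wJ vw wj aJ [c cJ ac].
pose z i := v i * w j - w i * v j.
pose eps : F := (-1) ^ (w j) * (-1) ^ (- v j).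
have epsE : eps = 1 \/ eps = -1.
  rewrite /eps; have [->|->] := expfz_N1 F (w j); have [->|->] := expfz_N1 F (- v j);
    rewrite ?mulrNN ?mulr1 ?mul1r; do [by left | by right].
exists (mono y z - eps); split.
- apply: rpredB; last by case: epsE => ->; rewrite ?rpredN1 ?rpred1.
  apply: mono_lau => i; rewrite !inE; have [->|ij] := eqVneq i j.
    by rewrite /z [w j * _]mulrC subrr eqxx.
  move=> /=; apply: contraNT => iJ; rewrite /z.
  by have [vi wi] : v i = 0 /\ w i = 0; 
    [split; apply: contraNeq iJ => ?; auto | rewrite vi wi !mul0r subrr].
(* E vanishes only if z = 0, which is a linear relation between v and w with the non-zero
   coefficient w_j. *)
- rewrite subr_eq0; apply/eqP => zE.
  have zeq : z =1 (fun=> 0).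
    have oneK : (1 : K) != 0 by exact: oner_neq0.
    case: epsE => epsE; rewrite epsE in zE.
      have E1 : iota 1 * mono y z = iota 1 * mono y (fun=> 0) by rewrite zE mono0.
      exact: (mono_inj y_indep oneK E1).2.
    have E1 : iota 1 * mono y z = iota (-1) * mono y (fun=> 0).
      by rewrite zE mono0 rmorphN1 rmorph1 mulr1 mul1r.
    exact: (mono_inj y_indep oneK E1).2.
  have [|wj0 _] := vw (w j) (- v j); last by rewrite wj0 eqxx in wj.
  by move=> i; rewrite mulrN; exact: zeq.
have [s sT Ev] := expfz_modN1 (T := lau y J) (w j)
  (mono_lau iota y vJ) (mono_lauV vJ) (mono_neq0 v y0).
have [t tT Ew] := expfz_modN1 (T := lau y J) (- v j)
  (mono_lau iota y wJ) (mono_lauV wJ) (mono_neq0 w y0).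
have zE : mono y z = mono y v ^ w j * mono y w ^ (- v j).
  by rewrite -!mono_exp -monoD//; apply: eq_mono => i; rewrite /z mulrN.
(* Expand y^z = (y^v)^(w_j) (y^w)^(-v_j), each power being a sign plus a multiple of 1 + y^v or 1 +
   y^w; then a (1 + y^v) is replaced by c (1 + y^w). *)
exists (a * (-1) ^ w j * t + s * c * mono y w ^ (- v j)).
  rewrite rpredD// ?rpredM// ?Ew.
    by have [->|->] := expfz_N1 F (w j); rewrite ?rpredN1 ?rpred1.
  rewrite rpredD ?rpredM ?rpredD ?rpred1 ?mono_lau//.
  by have [->|->] := expfz_N1 F (- v j); rewrite ?rpredN1 ?rpred1.
have -> : (a * (-1) ^ w j * t + s * c * mono y w ^ (- v j)) * (1 + mono y w) =
   a * (-1) ^ w j * (t * (1 + mono y w)) + s * (c * (1 + mono y w)) * mono y w ^ (- v j).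
  by ring.
rewrite -ac zE Ev Ew /eps; ring.
Qed.

(** By [eliminate], 1 + y^w divides a E with E free of y_j. As a polynomial in y_j, 1 + y^w has
    constant term 1, so E divides the quotient and can be cancelled. *)
Lemma coprime_binomials_gt0 (J : {set _}) v w j a : (forall i, v i != 0 -> i \in J) ->
    (forall i, w i != 0 -> i \in J) -> independent_columns v w ->
    0 < w j -> a \in lau y J ->
    divides_in (lau y J) (binomial y w) (binomial y v * a) ->
  divides_in (lau y J) (binomial y w) a.
Proof.
move=> vJ wJ vw wj aJ /divides_in_binomial-/(_ wJ) dvd.
apply/(divides_in_binomial _ wJ).
have jJ : j \in J by apply: wJ; lia.
have wj0 : w j != 0 by lia.
have [E [EJ E0 [c cJ aE]]] : exists E, [/\ E \in lau y (J :\ j), E != 0 &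
    divides_in (lau y J) (1 + mono y w) (a * E)].
  apply: (eliminate vJ wJ vw wj0 aJ).
  have [c cJ ac] := dvd; pose e i := Num.max (- v i) 0.
  have eJ i : e i != 0 -> i \in J by move=> ei; apply: vJ; move: ei; rewrite /e; lia.
  exists ((mono y e)^-1 * c); first by rewrite rpredM// mono_lauV.
  by rewrite -mulrA -ac binomial_factor// -/e -mulrA mulKf// mono_neq0.
have yj0 := y0 j.
have [N1 [p [pS ap]]] := lau_peel yj0 aJ.
have [N2 [q [qS cq]]] := lau_peel yj0 cJ.
pose e := mono y (fun i => if i == j then 0 else w i).
have eS : e \in lau y (J :\ j).
  apply: mono_lau => i; case: ifP => [_ /eqP//|ij /wJ iJ].
  by rewrite !inE ij.
case: (w j) (mono_split j y w) wj {wj0 vw} => // d wE d0; rewrite -/e -exprnP in wE.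
pose D : {poly F} := 1 + e *: 'X^d.
have Dx : D.[y j] = 1 + mono y w.
  by rewrite /D hornerD hornerZ hornerXn -(polyC1) hornerC wE; congr (_ + _); exact: mulrC.
pose P := p * 'X^N2; pose Q := q * 'X^N1.
have PS : P \is a polyOver (lau y (J :\ j)) by rewrite rpredM ?rpredX ?polyOverX.
have QS : Q \is a polyOver (lau y (J :\ j)) by rewrite rpredM ?rpredX ?polyOverX.
have PQ : E *: P = Q * D.
  apply: (transcendental_inj (@lau_transcendental_setD1 _ _ _ _ _ y_indep J j)).
  - by rewrite polyOverZ.
  - by rewrite rpredM// rpredD ?rpred1// polyOverZ// rpredX ?polyOverX.
  rewrite hornerZ !hornerM !hornerXn Dx -ap -cq.
  have -> : E * (a * y j ^+ N1 * y j ^+ N2) = a * E * (y j ^+ N1 * y j ^+ N2) by ring.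
  by rewrite aE; ring.
have coefE i : E * P`_i = Q`_i + e * (if (i < d)%N then 0 else Q`_(i - d)).
  by rewrite -coefZ PQ /D mulrDr mulr1 -scalerAr coefD coefZ [(Q * _)`_i]coefMXn.
(* From low degrees upwards: Q_i = E P_i - e Q_(i-d), so divisibility by E is inherited. *)
have VQ i : E^-1 * Q`_i \in lau y (J :\ j).
  elim/ltn_ind: i => i IHi.
  have -> : E^-1 * Q`_i = P`_i - e * (if (i < d)%N then 0 else E^-1 * Q`_(i - d)).
    by apply: (mulfI E0); rewrite mulVKf// mulrBr coefE; case: ifP => _;
      rewrite ?mulr0 ?subr0 ?addr0// [E * (e * _)]mulrCA mulVKf// addrK.
  rewrite rpredB//; first exact: (polyOverP PS).
  rewrite rpredM//; case: ltnP => di; first exact: rpred0.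
  by apply: IHi; rewrite ltn_subrL -ltz_nat d0 (leq_trans _ di).
have QD : P = (E^-1 *: Q) * D by rewrite -scalerAl -PQ scalerA mulVf// scale1r.
apply: (ex_intro2 _ _ ((E^-1 *: Q).[y j] * (y j)^-1 ^+ (N1 + N2))).
  rewrite rpredM ?rpredX ?lau_varV//.
  apply: (horner_in_subring (S := lau y (J :\ j))); last exact: lau_var.
    by apply/polyOverP => i; rewrite coefZ.
  exact/lau_sub/subD1set.
rewrite mulrAC -Dx -hornerM -QD hornerM hornerXn -ap exprVn exprD.
by rewrite -(mulrA a) mulfK// mulf_neq0// expf_neq0.
Qed.

Lemma coprime_binomials (J : {set _}) v w a : (forall i, v i != 0 -> i \in J) ->
    (forall i, w i != 0 -> i \in J) -> independent_columns v w ->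
    a \in lau y J ->
    divides_in (lau y J) (binomial y w) (binomial y v * a) ->
  divides_in (lau y J) (binomial y w) a.
Proof.
move=> vJ wJ vw aJ.
have /existsNP[j /eqP wj] : ~ forall j, w j = 0.
  by move=> w0; have [|_ /eqP] := vw 0 1; rewrite ?oner_eq0// => i;
    rewrite w0 mulr0 mul0r.
have [wj_gt0|wj_le0] := ltP 0 (w j); first exact: coprime_binomials_gt0 wj_gt0 aJ.
rewrite -(binomialN y w); apply: (@coprime_binomials_gt0 _ _ _ j) => //.
- by move=> i; rewrite oppr_eq0; exact: wJ.
- move=> b c vw0; have [|-> /eqP] := vw b (- c); last by rewrite oppr_eq0 => /eqP.
  by move=> i; rewrite mulrN -mulNr; exact: vw0.
- by rewrite oppr_gt0 lt_neqAle wj.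
Qed.

End Coprime.

(** * The Laurent rings of two consecutive mutations *)

Section RankTwoZero.
Variables (K : idomainType) (F : fieldType) (iota : {rmorphism K -> F}).
Variables (N n : nat) (mu : 'I_n -> 'I_N).
Hypothesis mu_inj : injective mu.
Implicit Types (y : 'I_N -> F) (B : 'I_N -> 'I_n -> int).
Local Notation lau := (lau iota).
Local Notation mutate_matrix := (mutate_matrix mu).
Local Notation mutate_vars := (mutate_vars mu).

(** Expand c in [y (mu k)]. That P_l^j c lies in the mutated ring means that powers of P_k divide
    P_l^j p_i; coprimality removes P_l^j, and c itself lies in the mutated ring. *)
Lemma coprime_flip y B k l j c :
    alg_independent iota y -> k != l -> B (mu k) k = 0 -> B (mu l) l = 0 ->
    B (mu k) l = 0 -> B (mu l) k = 0 -> independent_columns (B^~ l) (B^~ k) ->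
    let yk := mutate_vars k B y in
    let J := [set: 'I_N] :\ mu l in
    yk (mu k) != 0 ->
    c \in lau y J -> binomial y (B^~ l) ^+ j * c \in lau yk J -> c \in lau yk J.
Proof.
move=> yi kl Bkk Bll Bkl Blk ind yk J x'0 cJ PcJ.
have y0 := alg_independent_neq0 yi.
pose R := lau y (J :\ mu k).
have BlR : binomial y (B^~ l) \in R.
  apply: binomial_mem => i Bi; apply: lau_var; rewrite !inE andbT.
  by apply/andP; split; apply: contraNneq Bi => ->; rewrite ?Bkl ?Bll.
have BkR : binomial y (B^~ k) \in R.
  apply: binomial_mem => i Bi; apply: lau_var; rewrite !inE andbT.
  by apply/andP; split; apply: contraNneq Bi => ->; rewrite ?Bkk ?Blk.
have Bk0 : binomial y (B^~ k) != 0.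
  by apply: contraNneq x'0 => P0; rewrite /yk mutate_vars_eq P0 mulr0.
have ykE i : i != mu k -> yk i = y i by exact: mutate_vars_neq.
have RJ : {subset R <= lau yk J}.
  move=> f fR; apply: (lau_sub (J := J :\ mu k)); first exact: subD1set.
  by apply: lau_eq fR => i; rewrite !inE => /andP[ik _]; rewrite ykE.
have xS := @lau_transcendental_setD1 _ _ _ _ _ yi J (mu k).
have kJ : mu k \in J by rewrite !inE (inj_eq mu_inj) kl.
have [M [p [pR cp]]] := lau_peel (y0 (mu k)) cJ.
have flip := @laurent_ext_flip _ _ _ (binomial y (B^~ l) ^+ j * c)
  (binomial y (B^~ k)) (binomial y (B^~ l) ^+ j *: p) M xS BkR Bk0.
have dvd i : (i < M)%N -> divides_in R (binomial y (B^~ k) ^+ (M - i)) p`_i.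
  move=> iM; apply: (divides_in_exp BlR BkR Bk0 _ (i := j)).
  - move=> a aR; apply: (coprime_binomials yi) => // i0 Bi; rewrite !inE andbT;
      by apply/andP; split; apply: contraNneq Bi => ->; rewrite ?Bkl ?Bll ?Bkk ?Blk.
  - exact: (polyOverP pR).
  rewrite -coefZ; apply: flip => //.
  - by rewrite polyOverZ ?rpredX.
  - by rewrite hornerZ -cp mulrA.
  rewrite -mutate_vars_eq; apply: laurent_ext_subring (lau_peel x'0 PcJ) => //.
  by apply: lau_eq => i0; rewrite !inE => /andP[ik _]; rewrite ykE.
have [q [r [qR rR -> _ _]]] := laurent_ext_unflip (y0 (mu k)) BkR pR cp dvd.
rewrite -mutate_vars_eq rpredD//; apply: (horner_in_subring (S := R)) => //.
  have -> : y (mu k) = binomial y (B^~ k) * (yk (mu k))^-1.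
    by rewrite -(exchange_relation B (y0 (mu k))) mulfK.
  by apply: rpredM; [exact: RJ | exact: lau_varV].
exact: lau_var.
Qed.

Lemma mul_coefXn (p q : {poly F}) a b i : p * 'X^a = q * 'X^b ->
  p`_i = if (i + a < b)%N then 0 else q`_(i + a - b).
Proof.
move=> /(congr1 (fun r : {poly F} => r`_(i + a))).
by rewrite !coefMXn ltnNge leq_addl /= addnK.
Qed.

(** Here the two mutations commute: [y2] is [y1] at k and [yl] elsewhere. It remains to divide the
    coefficients of f, as a polynomial in [y (mu k)], by powers of P_k over the variables [yl] other
    than [yl (mu k)]. *)
Lemma rank_two_zero y B k l f :
    alg_independent iota y -> k != l -> B (mu k) k = 0 -> B (mu l) l = 0 ->
    B (mu k) l = 0 -> B (mu l) k = 0 -> independent_columns (B^~ k) (B^~ l) ->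
    let y1 := mutate_vars k B y in
    let y2 := mutate_vars l (mutate_matrix k B) y1 in
    let yl := mutate_vars l B y in
    (forall i, y1 i != 0) -> (forall i, y2 i != 0) -> yl (mu l) != 0 ->
    f \in lau y setT -> f \in lau y1 setT -> f \in lau yl setT ->
  f \in lau y2 setT.
Proof.
move=> yi kl Bkk Bll Bkl Blk ind y1 y2 yl y10 y20 yl0 fy fy1 fyl.
have y0 := alg_independent_neq0 yi.
have mkl : mu k != mu l by rewrite (inj_eq mu_inj).
have y1E i : i != mu k -> y1 i = y i by exact: mutate_vars_neq.
have ylE i : i != mu l -> yl i = y i by exact: mutate_vars_neq.
have B1 i : mutate_matrix k B i l = B i l.
  rewrite /mutate_matrix [l == k]eq_sym (negPf kl) orbF.
  by case: eqP => [->|_]; rewrite Bkl ?oppr0// mulr0 maxxx mulr0 addr0.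
have y2l : y2 (mu l) = yl (mu l).
  rewrite /y2 /yl !mutate_vars_eq y1E 1?eq_sym//; congr (_ * _).
  rewrite (eq_binomial _ B1); apply: binomial_eq => i Bi.
  by rewrite y1E//; apply: contraNneq Bi => ->; rewrite Bkl.
have y2E i : i != mu k -> y2 i = yl i.
  move=> ik; have [->//|il] := eqVneq i (mu l).
  by rewrite /y2 mutate_vars_neq// y1E// ylE.
have y2k : y2 (mu k) = y1 (mu k) by exact: mutate_vars_neq.
pose J := [set: 'I_N] :\ mu k; pose W := lau y2 setT.
have SW : {subset lau yl J <= W}.
  move=> g gS; apply: (lau_sub (subsetT J)); apply: lau_eq gS => i.
  by rewrite !inE andbT => ik; rewrite y2E.
have PS : binomial y (B^~ k) \in lau y J.
  apply: binomial_mem => i Bi; apply: lau_var; rewrite !inE andbT.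
  by apply: contraNneq Bi => ->; rewrite Bkk.
have PS' : binomial y (B^~ k) \in lau yl J.
  apply: binomial_mem => i Bi; rewrite -ylE; last first.
    by apply: contraNneq Bi => ->; rewrite Blk.
  by apply: lau_var; rewrite !inE andbT; apply: contraNneq Bi => ->; rewrite Bkk.
have P0 : binomial y (B^~ k) != 0.
  by apply: contraNneq (y10 (mu k)) => P0; rewrite /y1 mutate_vars_eq P0 mulr0.
have xS := @lau_transcendental_setD1 _ _ _ _ _ yi setT (mu k).
have [M [p [pS fp]]] := lau_peel (y0 (mu k)) fy.
have flip : forall i, (i < M)%N -> divides_in (lau y J) (binomial y (B^~ k) ^+ (M - i)) p`_i.
  apply: (laurent_ext_flip xS PS P0 pS fp).
  rewrite -mutate_vars_eq; apply: laurent_ext_subring (lau_peel (y10 (mu k)) fy1) => //.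
  by apply: lau_eq => i; rewrite !inE andbT => ik; rewrite y1E.
have ylk : yl (mu k) = y (mu k) by rewrite ylE.
have ylk0 : yl (mu k) != 0 by rewrite ylk.
have [M' [p' [pS' fp']]] := lau_peel ylk0 fyl.
have BlS : binomial y (B^~ l) \in lau y J.
  apply: binomial_mem => i Bi; apply: lau_var; rewrite !inE andbT.
  by apply: contraNneq Bi => ->; rewrite Bkl.
have Bl0 : binomial y (B^~ l) != 0.
  by apply: contraNneq yl0 => Q0; rewrite /yl mutate_vars_eq Q0 mulr0.
have lJ : mu l \in J by rewrite !inE eq_sym mkl.
(* Over the old variables, elements of the mutated coefficient ring have powers of P_l as
   denominators. *)
have frac g : g \in lau yl J -> g \in localization BlS.
  have sub h : h \in lau y J -> h \in localization BlS by exact: localize_sub.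
  move: g; apply: lau_min => [c|i iJ|i iJ]; first exact/sub/lau_iota.
    have [->|il] := eqVneq i (mu l); last by rewrite ylE//; exact/sub/lau_var.
    by rewrite /yl mutate_vars_eq rpredM// sub ?lau_varV.
  have [->|il] := eqVneq i (mu l); last by rewrite ylE//; exact/sub/lau_varV.
  rewrite /yl mutate_vars_eq invfM invrK rpredM//; first exact/sub/lau_var.
  exact: localizeV.
(* The expansions of f over the two coefficient rings agree: clear the powers of P_l and use
   transcendence. *)
have pp' : p * 'X^M' = p' * 'X^M.
  apply/eqP; rewrite -subr_eq0; apply/eqP; apply: (transcendental_frac xS) => [i|].
    have iS q : q \is a polyOver (lau yl J) -> exists d,
        [/\ d \in lau y J, d != 0 & d * q`_i \in lau y J].
      move=> /polyOverP /(_ i) /frac /localizeP[s sS].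
      by exists (binomial y (B^~ l) ^+ s); rewrite rpredX// expf_neq0.
    have [d [dS d0 dp]] : exists d, [/\ d \in lau y J, d != 0 & d * (p' * 'X^M)`_i \in lau y J].
      by apply: iS; rewrite rpredM ?rpredX ?polyOverX.
    exists d; split=> //; rewrite coefB mulrBr rpredB// rpredM//.
    by apply: polyOverP; rewrite rpredM ?rpredX ?polyOverX.
  rewrite hornerD hornerN !hornerM !hornerXn -fp -[in p'.[_]]ylk -fp' ylk; ring.
have pS'' : p \is a polyOver (lau yl J).
  apply/polyOverP => i; rewrite (mul_coefXn i pp').
  by case: ifP => _; rewrite ?rpred0//; exact: (polyOverP pS').
(* [coprime_flip] with k and l interchanged: the quotient by the power of P_k also belongs to the
   mutated coefficient ring. *)
have flip' i : (i < M)%N -> divides_in (lau yl J) (binomial y (B^~ k) ^+ (M - i)) p`_i.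
  move=> iM; have [c cS pc] := flip i iM; exists c => //.
  apply: (@coprime_flip y B l k (M - i)) => //; rewrite 1?eq_sym//.
  by rewrite mulrC -pc; exact: (polyOverP pS'').
have [q [r [qS rS -> _ _]]] := laurent_ext_unflip (y0 (mu k)) PS' pS'' fp flip'.
rewrite -mutate_vars_eq rpredD//; apply: (horner_in_subring (S := lau yl J)) => //.
  have -> : y (mu k) = binomial y (B^~ k) * (y1 (mu k))^-1.
    by rewrite -(exchange_relation B (y0 (mu k))) mulfK.
  by apply: rpredM; [exact: SW | rewrite -y2k lau_varV].
by rewrite -/y1 -y2k lau_var.
Qed.

End RankTwoZero.

(** * Extended seeds *)

Section Specialize.
Variables (K : idomainType) (m n : nat).
Local Notation KP := (group_ring K m).
Local Notation F := (ambient K m n).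

Lemma scalar_zmod : zmod_morphism (@Defs.scalar K m n).
Proof. by move=> a b; rewrite /Defs.scalar mpolyCB tofracB. Qed.

Lemma scalar_monoid : monoid_morphism (@Defs.scalar K m n).
Proof. by split=> [|a b]; rewrite /Defs.scalar ?mpolyC1 ?mpolyCM ?tofracM ?tofrac1. Qed.

HB.instance Definition _ :=
  GRing.isZmodMorphism.Build KP F (@Defs.scalar K m n) scalar_zmod.
HB.instance Definition _ :=
  GRing.isMonoidMorphism.Build KP F (@Defs.scalar K m n) scalar_monoid.

Lemma laurent_const_subproof (c : K) : tofrac (c%:MP : {mpoly K[m]}) \in @laurent K m.
Proof. by apply/laurentP; exists 0%MM, c%:MP; rewrite mpolyX0 mulr1. Qed.

Definition group_ring_const (c : K) : KP := GroupRing (laurent_const_subproof c).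

Lemma group_ring_const_zmod : zmod_morphism group_ring_const.
Proof. by move=> a b; apply: val_inj; rewrite /= mpolyCB tofracB. Qed.

Lemma group_ring_const_monoid : monoid_morphism group_ring_const.
Proof.
by split=> [|a b]; apply: val_inj; rewrite /= ?mpolyC1 ?mpolyCM ?tofracM ?tofrac1.
Qed.

HB.instance Definition _ :=
  GRing.isZmodMorphism.Build K KP group_ring_const group_ring_const_zmod.
HB.instance Definition _ :=
  GRing.isMonoidMorphism.Build K KP group_ring_const group_ring_const_monoid.

Definition coeff_embed : {rmorphism K -> F} := @Defs.scalar K m n \o group_ring_const.

Implicit Types s : labeled_triple K m n.

Definition ext_vars s (i : 'I_(n + m)) : F :=
  match split i with inl j => exA s j | inr j => Defs.scalar n (Zvar K j) end.

Definition ext_mat s (i : 'I_(n + m)) (k : 'I_n) : int := extended_exchange_matrix s i k.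

Lemma ext_varsl s j : ext_vars s (lshift m j) = exA s j.
Proof.
rewrite /ext_vars; case: splitP => i /= E; last by have := ltn_ord j; lia.
by congr (exA s _); apply: val_inj.
Qed.

Lemma ext_varsr s j : ext_vars s (rshift n j) = Defs.scalar n (Zvar K j).
Proof.
rewrite /ext_vars; case: splitP => i /= E; first by have := ltn_ord i; lia.
by congr (Defs.scalar n (Zvar K _)); apply: val_inj; move: E => /=; lia.
Qed.

Lemma ext_matl s i k : ext_mat s (lshift m i) k = exB s i k.
Proof. by rewrite /ext_mat /extended_exchange_matrix col_mxEu. Qed.

Lemma ext_matr s i k : ext_mat s (rshift n i) k = exX s k i 0.
Proof. by rewrite /ext_mat /extended_exchange_matrix col_mxEd mxE. Qed.

Lemma scalar_Zmon (e : 'cV[int]_m) :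
  Defs.scalar n (Zmon K e) = \prod_i Defs.scalar n (Zvar K i) ^ e i 0.
Proof.
rewrite rmorph_prod; apply: eq_bigr => i _.
by rewrite rmorphXz// Zvar_unit.
Qed.

Lemma mono_ext s (e : 'I_(n + m) -> int) :
  mono (ext_vars s) e = (\prod_i exA s i ^ e (lshift m i)) *
    \prod_j Defs.scalar n (Zvar K j) ^ e (rshift n j).
Proof.
rewrite /mono big_split_ord; congr (_ * _); apply: eq_bigr => i _.
  by rewrite ext_varsl.
by rewrite ext_varsr.
Qed.

(** For an exponent c of X_k, the coefficients X_k / (1 + X_k) and 1 / (1 + X_k), with tropical sum,
    have exponents c - min(0, c) = max(c, 0) and -min(0, c) = max(-c, 0). *)
Lemma exchange_binomialE k s :
  exchange_binomial k s = binomial (ext_vars s) (ext_mat s ^~ k).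
Proof.
rewrite /exchange_binomial /binomial !mono_ext !scalar_Zmon.
congr (_ + _); rewrite mulrC; congr (_ * _).
- rewrite big_mkcond; apply: eq_bigr => i _; rewrite ext_matl.
  by case: ltP => _; rewrite ?expr0z.
- apply: eq_bigr => i _; rewrite ext_matr !mxE.
  by move: (exX s k i 0 : int) => c; congr (_ ^ _); lia.
- rewrite big_mkcond; apply: eq_bigr => i _; rewrite ext_matl.
  by rewrite -oppr_gt0; case: ltP => _; rewrite ?expr0z.
- apply: eq_bigr => i _; rewrite ext_matr !mxE.
  by move: (exX s k i 0 : int) => c; congr (_ ^ _); lia.
Qed.

Lemma split_ind (P : 'I_(n + m) -> Prop) :
  (forall i, P (lshift m i)) -> (forall i, P (rshift n i)) -> forall i, P i.
Proof. by move=> Pl Pr i; rewrite -(splitK i); case: split. Qed.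

Lemma ext_vars_mutation k s :
  ext_vars (mutation k s) = mutate_vars (@lshift n m) k (ext_mat s) (ext_vars s).
Proof.
apply: funext; apply: split_ind => i.
  rewrite /mutate_vars !ext_varsl /= ffunE eq_lshift.
  by case: ifP => // /eqP ->; rewrite exchange_binomialE.
by rewrite /mutate_vars eq_rlshift !ext_varsr.
Qed.

(** On exponents the tropical rule adds c max(b, 0) - b min(0, c), which equals sgn(c) max(c b, 0)
    for all signs of b and c. *)
Lemma ext_mat_mutation k s :
  ext_mat (mutation k s) = mutate_matrix (@lshift n m) k (ext_mat s).
Proof.
apply: funext; apply: split_ind => i; apply: funext => j; rewrite /mutate_matrix.
  by rewrite !ext_matl /= mxE eq_lshift.
rewrite eq_rlshift /= !ext_matr ext_matl /= ffunE; case: ifP => [/eqP ->|_].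
  by rewrite mxE.
have mulzE (v : 'cV[int]_m) (z : int) : (v *~ z) i 0 = v i 0 * z.
  by case: z => z; rewrite ?NegzE ?mulrNz ?mxE -!pmulrn mulmxnE -mulr_natr ?mulrN natz.
rewrite !mxE !mulzE !mxE -!addrA; congr (_ + _).
move: (exX s k i 0 : int) (exB s k j : int) => c b.
have [b0|b0] := leP 0 b; have [c0|c0|->] := ltrgtP c 0;
  rewrite ?sgr0 ?(gtr0_sg c0) ?(ltr0_sg c0); nia.
Qed.

End Specialize.

(** In characteristic 0 the integers embed into K. This makes the Laurent phenomenon available with
    integer coefficients. *)
Lemma alg_independent_int (K : idomainType) (F : fieldType)
    (iota : {rmorphism K -> F}) (N : nat) (y : 'I_N -> F) :
  [pchar K] =i pred0 -> alg_independent iota y ->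
  alg_independent (intr : {rmorphism int -> F}) y.
Proof.
move=> K0 yi p py; apply/mpolyP => e; rewrite mcoeff0.
have : mmap iota y (map_mpoly (intr : {rmorphism int -> K}) p) = 0.
  rewrite -py /map_mpoly /= [in RHS]/mmap [X in mmap iota y X]/mmap raddf_sum.
  apply: eq_bigr => k _; rewrite /= rmorphM /= mmapC; congr (_ * _); first exact: rmorph_int.
  rewrite /mmap1 rmorph_prod; apply: eq_bigr => i _.
  by rewrite rmorphXn /= mmapX mmap1U.
move=> /yi /(congr1 (mcoeff e)); rewrite mcoeff_map_mpoly mcoeff0.
have natK (k : nat) : k%:R = 0 :> K -> k = 0%N.
  by move=> /eqP; rewrite (proj1 (pcharf0P K) K0) => /eqP.
case: (p@_e) => k /=; first by rewrite -pmulrn => /natK ->.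
by rewrite NegzE mulrNz => /eqP; rewrite oppr_eq0 => /eqP /natK.
Qed.

(** * Independence and Laurent ring of an extended seed *)

Section ExtIndependent.
Variables (K : idomainType) (m n : nat).
Local Notation KP := (group_ring K m).
Local Notation F := (ambient K m n).
Local Notation scal := (@Defs.scalar K m n).
Local Notation gc := (@group_ring_const K m).
Variable s : labeled_triple K m n.
Local Notation A := (exA s).
Local Notation y := (ext_vars s).

Lemma group_ring_val_sum (I : Type) (r : seq I) (P : pred I) (E : I -> KP) :
  val (\sum_(i <- r | P i) E i) = \sum_(i <- r | P i) val (E i).
Proof. exact: (big_morph (val : KP -> _) (id1 := 0) (op1 := +%R)). Qed.

Lemma group_ring_val_prod (I : Type) (r : seq I) (P : pred I) (E : I -> KP) :
  val (\prod_(i <- r | P i) E i) = \prod_(i <- r | P i) val (E i).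
Proof. exact: (big_morph (val : KP -> _) (id1 := 1) (op1 := *%R)). Qed.

Lemma group_ring_valX (x : KP) k : val (x ^+ k) = val x ^+ k.
Proof. by elim: k => // k IHk; rewrite !exprS /= IHk. Qed.

Definition Zpow (e : 'X_{1..m}) : KP := \prod_i Zvar K i ^+ e i.

Lemma val_Zpow e : val (Zpow e) = tofrac 'X_[e].
Proof.
rewrite group_ring_val_prod mpolyXE_id rmorph_prod; apply: eq_bigr => i _.
by rewrite group_ring_valX rmorphXn.
Qed.

Definition regroup_var (i : 'I_(n + m)) : {mpoly KP[n]} :=
  match split i with inl j => 'X_j | inr j => (Zvar K j)%:MP end.

Definition regroup (p : {mpoly K[n + m]}) : {mpoly KP[n]} :=
  mmap (@mpolyC n KP \o gc) regroup_var p.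

Definition lmult (e : 'X_{1..n + m}) : 'X_{1..n} := [multinom e (lshift m i) | i < n].
Definition rmult (e : 'X_{1..n + m}) : 'X_{1..m} := [multinom e (rshift n i) | i < m].

Lemma split_lshift (i : 'I_n) : split (lshift m i) = inl i.
Proof. exact: (unsplitK (inl i)). Qed.

Lemma split_rshift (i : 'I_m) : split (rshift n i) = inr i.
Proof. exact: (unsplitK (inr i)). Qed.

Lemma peval_regroup p : peval A (regroup p) = mmap (coeff_embed K m n) y p.
Proof.
rewrite /peval /regroup [in RHS]/mmap [X in mmap _ _ X]/mmap raddf_sum.
apply: eq_bigr => e _; rewrite /= rmorphM /= mmapC; congr (_ * _).
rewrite /mmap1 rmorph_prod; apply: eq_bigr => i _.
rewrite rmorphXn /=; congr (_ ^+ _); rewrite /regroup_var /ext_vars.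
by case: split => j; rewrite ?mmapC// mmapX mmap1U.
Qed.

Lemma regroup_coef p a :
  (regroup p)@_a = \sum_(e <- msupp p | lmult e == a) gc p@_e * Zpow (rmult e).
Proof.
rewrite /regroup /mmap raddf_sum [in RHS]big_mkcond; apply: eq_bigr => e _.
rewrite /= /mmap1 big_split_ord /=.
under eq_bigr do rewrite /regroup_var split_lshift.
under [X in _ * (_ * X)]eq_bigr do rewrite /regroup_var split_rshift -rmorphXn.
rewrite -rmorph_prod /= mcoeffCM.
have -> : \prod_(i < n) 'X_i ^+ e (lshift m i) = 'X_[lmult e] :> {mpoly KP[n]}.
  by rewrite [RHS]mpolyXE_id; apply: eq_bigr => i _; rewrite mnmE.
have -> : \prod_(i < m) Zvar K i ^+ e (rshift n i) = Zpow (rmult e).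
  by apply: eq_bigr => i _; rewrite mnmE.
rewrite mulrC mulrC [_ * (Zpow _)%:MP]mulrC mcoeffCM mcoeffX.
by case: eqP => _; rewrite ?mulr1 ?mulr0.
Qed.

Lemma multP (e e' : 'X_{1..n + m}) : lmult e = lmult e' -> rmult e = rmult e' -> e = e'.
Proof.
move=> /mnmP l /mnmP r; apply/mnmP; apply: split_ind => i.
  by have := l i; rewrite !mnmE.
by have := r i; rewrite !mnmE.
Qed.

Lemma regroup_eq0 p : regroup p = 0 -> p = 0.
Proof.
move=> p0; apply/mpolyP => e0; rewrite mcoeff0.
have [e0p|] := boolP (e0 \in msupp p); last by rewrite mcoeff_msupp negbK => /eqP.
have := regroup_coef p (lmult e0); rewrite p0 mcoeff0.
move=> /(congr1 val); rewrite group_ring_val_sum /=.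
under eq_bigr do rewrite val_Zpow -tofracM.
rewrite -rmorph_sum -tofrac0 => /eqP; rewrite tofrac_eq => /eqP.
move=> /(congr1 (mcoeff (rmult e0))); rewrite mcoeff0 raddf_sum /=.
rewrite big_mkcond (bigD1_seq e0) ?msupp_uniq//= eqxx mcoeffCM mcoeffX eqxx mulr1.
rewrite big1 ?addr0 => [<-//|e ee0]; case: eqP => // le.
rewrite mcoeffCM mcoeffX; case: eqP => re; last by rewrite mulr0.
by move: ee0; rewrite (multP le re) eqxx.
Qed.

Lemma ext_alg_independent : free_generating A -> alg_independent (coeff_embed K m n) y.
Proof. by move=> [Ai _] p py; apply/regroup_eq0/Ai; rewrite peval_regroup. Qed.

Hypothesis y_indep : alg_independent (coeff_embed K m n) y.
Local Notation L := (lau (coeff_embed K m n) y setT).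

Let A0 j : A j != 0.
Proof. by rewrite -ext_varsl; exact: (alg_independent_neq0 y_indep). Qed.

Lemma peval_Xn (e : 'X_{1..n}) : peval A 'X_[e] = \prod_i A i ^+ e i.
Proof. exact: mmapX. Qed.

Lemma pevalD p q : peval A (p + q) = peval A p + peval A q.
Proof. exact: mmapD. Qed.

Lemma pevalM p q : peval A (p * q) = peval A p * peval A q.
Proof. exact: rmorphM. Qed.

Lemma scalar_Zpow_lau e :
  [/\ scal (Zpow e) \in L, (scal (Zpow e))^-1 \in L & scal (Zpow e) != 0].
Proof.
have E : scal (Zpow e) = \prod_i y (rshift n i) ^+ e i.
  by rewrite rmorph_prod; apply: eq_bigr => i _; rewrite rmorphXn ext_varsr.
rewrite E; split.
- by apply: rpred_prod => i _; rewrite rpredX// lau_var.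
- by rewrite -prodfV; apply: rpred_prod => i _; rewrite -exprVn rpredX// lau_varV.
- by apply/prodf_neq0 => i _; rewrite expf_neq0// (alg_independent_neq0 y_indep).
Qed.

Lemma scalar_lau (c : KP) : scal c \in L.
Proof.
have polyL (q : {mpoly K[m]}) : exists c' : KP, val c' = tofrac q /\ scal c' \in L.
  elim/mpolyind: q => [|a e q _ _ [c' [c'q c'L]]].
    by exists 0; rewrite tofrac0 rmorph0 rpred0.
  exists (gc a * Zpow e + c'); split.
    by rewrite /= val_Zpow -tofracM c'q -tofracD mul_mpolyC.
  rewrite rmorphD rmorphM rpredD// rpredM//; last by have [] := scalar_Zpow_lau e.
  exact: (@lau_iota _ _ (coeff_embed K m n)).
have /laurentP[e [q cq]] := valP c.
have [c' [c'q c'L]] := polyL q.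
have [_ ZVL Z0] := scalar_Zpow_lau e.
have cZ : c * Zpow e = c' by apply: val_inj; rewrite /= val_Zpow cq c'q.
have -> : scal c = scal c' * (scal (Zpow e))^-1.
  by rewrite -cZ rmorphM mulfK.
by rewrite rpredM.
Qed.

Lemma peval_lau p : peval A p \in L.
Proof.
apply: rpred_sum => e _; rewrite rpredM ?scalar_lau//.
by apply: rpred_prod => i _; rewrite rpredX// -ext_varsl lau_var.
Qed.

(** The Z_i are units of the group ring, so Laurent polynomials in A over it are Laurent polynomials
    over K in all n + m variables. *)
Lemma laurent_ringP f : laurent_ring A f <-> f \in L.
Proof.
split=> [[p [e ->]]|/lauP].
  rewrite rpredM ?peval_lau// -prodfV; apply: rpred_prod => i _.
  by rewrite -exprVn rpredX// -ext_varsl lau_varV.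
have den0 (e : 'X_{1..n}) : \prod_i A i ^+ e i != 0.
  by apply/prodf_neq0 => i _; rewrite expf_neq0.
have den1 : \prod_i A i ^+ (0%MM : 'X_{1..n}) i = 1.
  by rewrite big1// => i _; rewrite mnm0E.
have denD (e e' : 'X_{1..n}) : \prod_i A i ^+ (e + e')%MM i =
    (\prod_i A i ^+ e i) * \prod_i A i ^+ e' i.
  by rewrite -big_split; apply: eq_bigr => i _; rewrite mnmDE exprD.
have scalar_case c : laurent_ring A (scal c).
  by exists c%:MP, 0%MM; rewrite den1 divr1 /peval mmapC.
elim=> [c|j _|j _|_ _ _ [p [e ->]] _ [q [e' ->]]|_ _ _ [p [e ->]] _ [q [e' ->]]].
- exact: scalar_case.
- move: j; apply: split_ind => j; rewrite ?ext_varsl ?ext_varsr//.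
  by exists 'X_j, 0%MM; rewrite den1 divr1 /peval mmapX mmap1U.
- move: j; apply: split_ind => j; rewrite ?ext_varsl ?ext_varsr; last first.
    have <- : scal (Zvar K j)^-1 = (scal (Zvar K j))^-1 by rewrite rmorphV ?Zvar_unit.
    exact: scalar_case.
  exists 1, U_(j)%MM; rewrite -peval_Xn /peval mmapX mmap1U.
  by rewrite rmorph1 mul1r.
- exists (p * 'X_[e'] + q * 'X_[e]), (e + e')%MM.
  rewrite pevalD !pevalM !peval_Xn denD.
  by rewrite addf_div.
- exists (p * q), (e + e')%MM; rewrite pevalM denD.
  by rewrite mulf_div.
Qed.

End ExtIndependent.

(** * Full rank and invariance of the upper bound *)

Section FullColumns.
Variables (N n : nat) (mu : 'I_n -> 'I_N).
Implicit Types (B : 'I_N -> 'I_n -> int).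

Definition full_columns B := forall x : 'I_n -> int,
  (forall i, \sum_j B i j * x j = 0) -> forall j, x j = 0.

Lemma full_columns_neq0 B k : full_columns B -> exists i, B i k != 0.
Proof.
move=> BF; apply/not_existsP => Bk0.
have /(_ k) : forall j, (j == k)%:Z = 0.
  apply: BF => i; rewrite (bigD1 k)//= big1 ?addr0 => [|j /negPf ->]; last by rewrite mulr0.
  by have /negP := Bk0 i; rewrite negbK => /eqP ->; rewrite mul0r.
by rewrite eqxx.
Qed.

Lemma full_columns_independent B k l : k != l -> full_columns B ->
  independent_columns (B^~ k) (B^~ l).
Proof.
move=> kl BF a b ab; pose x j := if j == k then a else if j == l then b else 0.
have x0 : forall j, x j = 0.
  apply: BF => i; rewrite (bigD1 k)//= (bigD1 l) 1?eq_sym//= /x !eqxx.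
  rewrite eq_sym (negPf kl) big1 ?addr0 => [|j /andP[/negPf -> /negPf ->]].
    exact: ab.
  by rewrite mulr0.
have := x0 k; have := x0 l; rewrite /x !eqxx eq_sym (negPf kl) => -> ->.
by [].
Qed.

(** A kernel vector [x] of the mutated matrix gives the kernel vector [x'] of B: up to multiples of
    row k, mutation is an invertible column operation, and row k of the mutated matrix makes the sum
    of the b_kj x_j vanish. *)
Lemma full_columns_mutate B k : B (mu k) k = 0 ->
  full_columns B -> full_columns (mutate_matrix mu k B).
Proof.
move=> Bkk BF x B'x.
pose S := \sum_(j | j != k) Num.max (B (mu k) j) 0 * x j.
pose x' j := if j == k then S - x k else x j.
have row_k : \sum_(j | j != k) B (mu k) j * x j = 0.
  have := B'x (mu k); rewrite (bigD1 k)//= /mutate_matrix eqxx /= Bkk oppr0 mul0r add0r.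
  under eq_bigr do rewrite mulNr.
  by rewrite sumrN => /eqP; rewrite oppr_eq0 => /eqP.
have x'0 : forall j, x' j = 0.
  apply: BF => i; rewrite (bigD1 k)//= {1}/x' eqxx.
  have -> : \sum_(j | j != k) B i j * x' j = \sum_(j | j != k) B i j * x j.
    by apply: eq_bigr => j /negPf jk; rewrite /x' jk.
  have [->|ik] := eqVneq i (mu k); first by rewrite Bkk mul0r add0r.
  have := B'x i; rewrite (bigD1 k)//= {1}/mutate_matrix eqxx orbT => B'xi.
  have : \sum_(j | j != k) mutate_matrix mu k B i j * x j =
      \sum_(j | j != k) B i j * x j + B i k * S
      + Num.max (- B i k) 0 * \sum_(j | j != k) B (mu k) j * x j.
    rewrite !mulr_sumr -!big_split; apply: eq_bigr => j /negPf jk.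
    rewrite /mutate_matrix (negPf ik) jk /=.
    move: (B i j) (B i k) (B (mu k) j) (x j) => a b c d.
    have -> : Num.sg b * Num.max (b * c) 0 = b * Num.max c 0 + Num.max (- b) 0 * c.
      have [b0|b0|->] := ltrgtP b 0; rewrite ?sgr0 ?(gtr0_sg b0) ?(ltr0_sg b0); nia.
    ring.
  rewrite row_k mulr0 addr0 => E; rewrite E in B'xi.
  move: B'xi; move: (\sum_(j | j != k) B i j * x j) (S) (B i k) (x k) => a b c d; nia.
have xj j : j != k -> x j = 0 by move=> /negPf jk; have := x'0 j; rewrite /x' jk.
move=> j; have [->|/xj//] := eqVneq j k.
have := x'0 k; rewrite /x' eqxx /S big1 => [|i /xj ->]; last by rewrite mulr0.
by rewrite sub0r => /eqP; rewrite oppr_eq0 => /eqP.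
Qed.

(** The sign pattern common to skew-symmetrizable matrices; for k = l it forces the diagonal entry
    to be 0. *)
Definition sign_skew B := forall k l,
  (0 < B (mu k) l) = (B (mu l) k < 0).

Lemma sign_skew_diag B k : sign_skew B -> B (mu k) k = 0.
Proof. by move=> /(_ k k); lia. Qed.

End FullColumns.

(** * Two consecutive mutations: all signs of the exchange entry *)

Section RankTwoAll.
Variables (K : idomainType) (F : fieldType) (iota : {rmorphism K -> F}).
Variables (N n : nat) (mu : 'I_n -> 'I_N).
Hypothesis mu_inj : injective mu.
Implicit Types (y : 'I_N -> F) (B : 'I_N -> 'I_n -> int).
Local Notation lau := (lau iota).

(** Controls the second mutation in terms of the initial seed and its two neighbours, which is what
    moves the upper bound across an edge. *)
Lemma rank_two y B k l f :
    alg_independent iota y -> k != l -> sign_skew mu B -> full_columns B ->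
    let y1 := mutate_vars mu k B y in
    let y2 := mutate_vars mu l (mutate_matrix mu k B) y1 in
    let yl := mutate_vars mu l B y in
    (forall i, y1 i != 0) -> (forall i, y2 i != 0) -> yl (mu l) != 0 ->
    f \in lau y setT -> f \in lau y1 setT -> f \in lau yl setT ->
  f \in lau y2 setT.
Proof.
move=> yi kl skew BF y1 y2 yl y10 y20 yl0 fy fy1 fyl.
have Bkk := sign_skew_diag k skew; have Bll := sign_skew_diag l skew.
have [Bkl|Bkl|Bkl] := ltrgtP (B (mu k) l) 0.
- have E1 : mutate_vars mu k (opp_matrix B) y = y1 by apply/funext/mutate_varsN.
  have EB : mutate_matrix mu k (opp_matrix B) = opp_matrix (mutate_matrix mu k B).
    by apply/funext => i; apply/funext => j; exact: mutate_matrixN.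
  have E2 : mutate_vars mu l (opp_matrix (mutate_matrix mu k B)) y1 = y2.
    by apply/funext/mutate_varsN.
  have El : mutate_vars mu l (opp_matrix B) y = yl by apply/funext/mutate_varsN.
  have := @rank_two_pos _ _ iota _ _ _ mu_inj y (opp_matrix B) k l f yi kl.
  rewrite /= E1 EB E2 El; apply=> //; rewrite /opp_matrix ?Bkk ?Bll ?oppr0 ?oppr_gt0//.
  by rewrite oppr_lt0 skew.
- by apply: (rank_two_pos mu_inj yi kl) => //; rewrite -skew.
- apply: (rank_two_zero mu_inj yi kl) => //; last exact: full_columns_independent.
  by have := skew k l; have := skew l k; lia.
Qed.

End RankTwoAll.

(** * Connectedness of the regular tree *)

Section Tree.
Variable n : nat.
Implicit Types t : Tn n.

Lemma Tn_edge_sym (k : 'I_n) t t' : Tn_edge k t t' -> Tn_edge k t' t.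
Proof. by case; [right | left]. Qed.

Lemma Tn_neighbor (k : 'I_n) t : exists t', Tn_edge k t t'.
Proof.
case: t => -[|j w] wP.
  by exists (exist _ [:: k] (isT : sorted _ [:: k])); left.
have [jk|jk] := eqVneq j k.
  by exists (exist _ w (path_sorted wP)); right => /=; rewrite jk.
have kP : sorted (fun i j => i != j) [:: k, j & w] by rewrite /= eq_sym jk.
by exists (exist _ [:: k, j & w] kP); left.
Qed.

(** Connectedness as an induction principle from any base vertex: deleting letters leads from every
    word to the empty one, and edges can be walked both ways. *)
Lemma Tn_ind (P : Tn n -> Prop) t0 : P t0 ->
  (forall k t t', Tn_edge k t t' -> P t -> P t') -> forall t, P t.
Proof.
move=> P0 Pe; pose root : Tn n := exist _ [::] isT.
have conn t : P t <-> P root.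
  case: t; elim=> [|j w IHw] wP.
    by rewrite (_ : exist _ [::] wP = root)//; apply: eq_exist.
  have e : Tn_edge j (exist _ w (path_sorted wP)) (exist _ (j :: w) wP) by left.
  rewrite -(IHw (path_sorted wP)); split; first exact/Pe/Tn_edge_sym/e.
  exact: Pe e.
by move=> t; apply/(conn t)/(conn t0).
Qed.

End Tree.

(** * Upper bounds, Laurent phenomenon and units along a pattern *)

Section Pattern.
Variables (K : idomainType) (F : fieldType) (iota : {rmorphism K -> F}).
Variables (N n : nat) (mu : 'I_n -> 'I_N).
Hypothesis mu_inj : injective mu.
Variables (y : Tn n -> 'I_N -> F) (B : Tn n -> 'I_N -> 'I_n -> int).
Hypothesis y_edge : forall k t t', Tn_edge k t t' ->
  y t' = mutate_vars mu k (B t) (y t).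
Hypothesis B_edge : forall k t t', Tn_edge k t t' ->
  B t' = mutate_matrix mu k (B t).
Hypothesis y_indep : forall t, alg_independent iota (y t).
Hypothesis B_skew : forall t, sign_skew mu (B t).
Hypothesis B_full : forall t, full_columns (B t).
Implicit Types t : Tn n.

Local Notation L t := (lau iota (y t) setT).

Let y0 t i : y t i != 0.
Proof. exact: (alg_independent_neq0 (@y_indep t)). Qed.

Definition upper_bound t f : Prop :=
  f \in L t /\ forall k t', Tn_edge k t t' -> f \in L t'.

(** The neighbour of [t'] in direction k carries the variables of [t]; one in direction l, distinct
    from k, is reached from [t] by mutating at k and then at l, as in [rank_two]. *)
Lemma upper_bound_edge k t t' f :
  Tn_edge k t t' -> upper_bound t f -> upper_bound t' f.
Proof.
move=> tt' [ft fN]; split=> [|l t'' t't'']; first exact: fN tt'.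
move: t't''; have [->|lk] := eqVneq l k => t't''.
  by rewrite (y_edge t't'') -(y_edge (Tn_edge_sym tt')).
have [tl ttl] := Tn_neighbor l t.
rewrite (y_edge t't'') (B_edge tt') (y_edge tt'); apply: rank_two => //.
- by rewrite eq_sym.
- by move=> i; rewrite -(y_edge tt').
- by move=> i; rewrite -(y_edge tt') -(B_edge tt') -(y_edge t't'').
- by rewrite -(y_edge ttl).
- by rewrite -(y_edge tt'); exact: fN tt'.
- by rewrite -(y_edge ttl); exact: fN ttl.
Qed.

Lemma upper_bound_mem t t' f : upper_bound t f -> f \in L t'.
Proof.
move=> ft; suff [] : upper_bound t' f by [].
move: t'; apply: Tn_ind ft _ => k t1 t2; exact: upper_bound_edge.
Qed.

Lemma edge_exchange k t t' : Tn_edge k t t' ->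
  y t (mu k) = binomial (y t) (B t ^~ k) * (y t' (mu k))^-1.
Proof.
move=> tt'; rewrite -(exchange_relation (B t) (y0 t (mu k))) -(y_edge tt').
by rewrite mulfK.
Qed.

Lemma edge_neq k t t' i : Tn_edge k t t' -> i != mu k -> y t' i = y t i.
Proof. by move=> /y_edge ->; exact: mutate_vars_neq. Qed.

Lemma edge_binomial k t t' : Tn_edge k t t' ->
  binomial (y t) (B t ^~ k) = binomial (y t') (B t ^~ k).
Proof.
move=> tt'; apply: binomial_eq => i Bi; rewrite (edge_neq tt')//.
by apply: contraNneq Bi => ->; rewrite (sign_skew_diag k (@B_skew t)).
Qed.

(** By the exchange relations a variable of [t] is Laurent at [t] and at its neighbours, so it
    belongs to the upper bound, which does not depend on the vertex. *)
Lemma laurent_phenomenon t t' i : y t i \in L t'.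
Proof.
apply: (@upper_bound_mem t); split=> [|k t1 tt1]; first exact: lau_var.
have [->|ik] := eqVneq i (mu k); last by rewrite -(edge_neq tt1)// lau_var.
rewrite (edge_exchange tt1) (edge_binomial tt1) rpredM ?lau_varV//.
by apply: binomial_mem => j _; exact: lau_var.
Qed.

Lemma frozen_eq t t' i : (forall k, i != mu k) -> y t' i = y t i.
Proof.
move=> ik; move: t'; apply: (@Tn_ind _ _ t) => // k t1 t2 e <-.
exact: edge_neq (ik k).
Qed.

(** In a variable y_j with non-zero exponent the binomial has the two terms c + a X^d, whereas a
    unit would divide a power of X and be a single term. *)
Lemma binomial_not_unit t (b : 'I_N -> int) j : b j != 0 ->
  (binomial (y t) b)^-1 \notin L t.
Proof.
wlog bj : b / 0 < b j => [IH bj0|_].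
  have [bj|bj] := ltP 0 (b j); first exact: IH.
  by rewrite -binomialN; apply: IH => //; rewrite ?oppr_eq0// oppr_gt0 lt_neqAle bj0.
apply/negP => PV; have x0 := y0 t j.
pose S := lau iota (y t) (setT :\ j).
pose a := mono (y t) (fun i => if i == j then 0 else Num.max (b i) 0).
pose c := mono (y t) (fun i => Num.max (- b i) 0).
have aS : a \in S by apply: mono_lau => i; rewrite !inE andbT; case: (i == j).
have cS : c \in S.
  by apply: mono_lau => i; rewrite !inE andbT; apply: contraNneq => ->; lia.
case bjE: (b j) bj => [d|//]; rewrite ltz_nat => d0.
pose p : {poly F} := c%:P + a *: 'X^d.
have px : p.[y t j] = binomial (y t) b.
  rewrite /p hornerD hornerZ hornerXn hornerC addrC; congr (_ + _).
  by rewrite [RHS](mono_split j) bjE max_l ?ltW// mulrC.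
have P0 : binomial (y t) b != 0.
  apply/eqP => P0; rewrite -px in P0.
  have /(congr1 (fun p : {poly F} => p`_0)) : p = 0.
    apply: (@lau_transcendental_setD1 _ _ _ _ _ (@y_indep t) setT j) => //.
    by rewrite rpredD// ?polyOverC// polyOverZ// rpredX ?polyOverX.
  rewrite coef0 coefD coefC coefZ coefXn (ltn_eqF d0) mulr0 addr0 => /eqP.
  by rewrite (negPf (mono_neq0 _ (y0 t))).
have [M [q [qS Pq]]] := lau_peel x0 PV.
have pq : p * q = 'X^M.
  apply: (transcendental_inj (@lau_transcendental_setD1 _ _ _ _ _ (@y_indep t) setT j)).
  - by rewrite rpredM// rpredD// ?polyOverC// polyOverZ// rpredX ?polyOverX.
  - by rewrite rpredX ?polyOverX.
  by rewrite hornerM hornerXn px -Pq mulrA mulfV// mul1r.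
have [u [i pE]] := mul_eqXn pq.
have pc : p`_0 = c by rewrite coefD coefC coefZ coefXn (ltn_eqF d0) mulr0 addr0.
have pd : p`_d = a by rewrite coefD coefC coefZ coefXn eqxx mulr1 (gtn_eqF d0) add0r.
have c0 : c != 0 by exact: mono_neq0.
have a0 : a != 0 by exact: mono_neq0.
move: c0 a0; rewrite -pc -pd pE !coefZ !coefXn.
case: i {pE} => [_|i]; last by rewrite mulr0 eqxx.
by rewrite (gtn_eqF d0) mulr0 eqxx.
Qed.

(** As a unit at [t], h is a monomial. A negative exponent of x = P / x' would put a negative power
    of P, and then P^-1, into the Laurent ring of the neighbour. *)
Lemma unit_exponents t h : (forall t', h \in L t') -> h^-1 \in L t -> h != 0 ->
  exists u v e, [/\ u * v = 1, h = iota u * mono (y t) e & forall i, 0 <= e (mu i)].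
Proof.
move=> hL hV h0; have [u [v [e [uv hE _]]]] := lau_unit (@y_indep t) (hL t) hV h0.
exists u, v, e; split=> // i; rewrite leNgt; apply/negP => ei.
have [t' tt'] := Tn_neighbor i t.
pose P := binomial (y t') (B t ^~ i).
have xE : y t (mu i) = P * (y t' (mu i))^-1.
  by rewrite (edge_exchange tt') (edge_binomial tt').
have [j Bj] := full_columns_neq0 i (@B_full t).
have := binomial_not_unit t' (b := B t ^~ i) Bj; rewrite -/P => /negP; apply.
pose e0 j := if j == mu i then 0 else e j.
have m0 : mono (y t) e0 = mono (y t') e0.
  apply: mono_eq => l; rewrite /e0; case: ifP => [_ /eqP//|/negbT li _].
  by rewrite (edge_neq tt').
have uv' : iota u * iota v = 1 by rewrite -rmorphM uv rmorph1.
have xL : y t (mu i) ^ e (mu i) \in L t'.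
  have -> : y t (mu i) ^ e (mu i) = h * iota v * mono (y t') (fun j => - e0 j).
    rewrite hE (mono_split (mu i)) -/e0 m0 monoN.
    have m0' : mono (y t') e0 != 0 by exact: mono_neq0.
    by rewrite [iota u * _]mulrC -[_ * iota v]mulrA uv' mulr1 mulfK.
  apply: rpredM; last by apply: mono_lau => l _; rewrite inE.
  by apply: rpredM; [exact: hL | exact: lau_iota].
case: (e (mu i)) ei xL => // s _; rewrite NegzE -exprnN -exprVn xE invfM invrK exprMn => xL.
have P0 : P != 0 by have := y0 t (mu i); rewrite xE mulf_eq0 negb_or => /andP[].
have -> : P^-1 = P^-1 ^+ s.+1 * y t' (mu i) ^+ s.+1 * (y t' (mu i))^-1 ^+ s.+1 * P ^+ s.
  rewrite -[_ * _ * _^-1 ^+ _]mulrA -[_ ^+ _ * _^-1 ^+ _]exprMn mulfV// expr1n mulr1.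
  by rewrite exprS exprVn mulfVK// expf_neq0.
apply: rpredM; first by apply: rpredM; [exact: xL | rewrite rpredX ?lau_varV].
by apply/rpredX/binomial_mem => l _; exact: lau_var.
Qed.

(** Both a and z / a are monomials with nonnegative cluster exponents, and these add up to those of
    z. So z occurs in exactly one of them; if not in a, then a would be a frozen monomial, against
    independence at [t0]. *)
Lemma divisor_of_cluster_variable t t0 i k :
    (forall t', y t (mu i) / y t0 (mu k) \in L t') ->
  exists u v e, [/\ u * v = 1, y t0 (mu k) = iota u * mono (y t) e &
    forall l, e (mu l) = (l == i)%:Z].
Proof.
set z := y t (mu i); set a := y t0 (mu k) => gL.
have aL t' : a \in L t' by exact: laurent_phenomenon.
have zV : z^-1 \in L t by exact: lau_varV.
have a0 : a != 0 by exact: y0.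
have z0 : z != 0 by exact: y0.
have aV : a^-1 \in L t.
  by rewrite -[a^-1](mulKf z0); apply: rpredM; [exact: zV | exact: gL].
have gV : (z / a)^-1 \in L t by rewrite invf_div; apply: rpredM; [exact: aL | exact: zV].
have [u [v [e [uv aE e0]]]] := unit_exponents aL aV a0.
have [|u' [v' [e' [uv' gE e'0]]]] := unit_exponents gL gV.
  by rewrite mulf_neq0// invr_neq0.
have ee' : (fun l => (l == mu i)%:Z) =1 (fun l => e l + e' l).
  have one0 : (1 : K) != 0 by exact: oner_neq0.
  apply: (mono_inj (@y_indep t) (u' := u * u') one0 _).2.
  rewrite mono_delta rmorph1 mul1r rmorphM monoD// mulrACA -aE -gE.
  by rewrite mulrC mulfVK.
exists u, v, e; split=> // l.
have := ee' (mu l); rewrite (inj_eq mu_inj).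
case: eqVneq => [->|_]; last by have := e0 l; have := e'0 l; lia.
move=> ei; have := e0 i; have := e'0 i; move: ei => /= ei.
have [ei0|ei0] := eqVneq (e (mu i)) 0; last by lia.
have ef l' : e (mu l') = 0.
  have [->//|l'i] := eqVneq l' i.
  have := ee' (mu l'); rewrite (inj_eq mu_inj) (negPf l'i).
  by have := e0 l'; have := e'0 l'; lia.
have : iota 1 * mono (y t0) (fun l => (l == mu k)%:Z) = iota u * mono (y t0) e.
  rewrite mono_delta rmorph1 mul1r -/a aE; congr (_ * _); apply: mono_eq => j ej.
  by apply: frozen_eq => l'; apply: contraNneq ej => ->; rewrite ef.
have one0 : (1 : K) != 0 by exact: oner_neq0.
by move=> /(mono_inj (@y_indep t0) one0)[_ /(_ (mu k))]; rewrite eqxx ef.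
Qed.

End Pattern.

(** * Positivity and integrality *)

Section Positivity.
Variables (K : idomainType) (F : fieldType) (iota : {rmorphism K -> F}).
Variables (N : nat) (y : 'I_N -> F).
Hypothesis K0 : [pchar K] =i pred0.
Hypothesis y_indep : alg_independent iota y.
Variable delta : 'I_N -> bool.

Local Notation ev := (mmap iota y).
Local Notation at_delta := (meval (fun i => (delta i)%:R : K)).

Lemma char0_natS_neq0 k : k.+1%:R != 0 :> K.
Proof. by rewrite (proj1 (pcharf0P K) K0). Qed.

(* [f] is regular with nonnegative (resp. positive) integral value at the 0/1
   point [delta], witnessed by a quotient of polynomials. *)
Definition semipos (f : F) : Prop := exists p q a c,
  [/\ at_delta p = a%:R, at_delta q = c.+1%:R & f * ev q = ev p].

Definition pos (f : F) : Prop := exists p q a c,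
  [/\ at_delta p = a.+1%:R, at_delta q = c.+1%:R & f * ev q = ev p].

Lemma ev_at_neq0 p a : at_delta p = a.+1%:R -> ev p != 0.
Proof.
move=> pa; apply/eqP => /y_indep p0; have := char0_natS_neq0 a.
by rewrite -pa p0 meval0 eqxx.
Qed.

Lemma pos_semipos f : pos f -> semipos f.
Proof. by move=> [p [q [a [c H]]]]; exists p, q, a.+1, c. Qed.

Lemma pos1 : pos 1.
Proof. by exists 1, 1, 0%N, 0%N; rewrite meval1 mul1r. Qed.

Lemma posV f : pos f -> pos f^-1.
Proof.
move=> [p [q [a [c [pa qc fpq]]]]]; exists q, p, c, a; split=> //.
have f0 : f != 0.
  by apply: contraTneq (ev_at_neq0 pa) => f0; rewrite -fpq f0 mul0r eqxx.
by rewrite -fpq mulKf.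
Qed.

Lemma posM f g : pos f -> pos g -> pos (f * g).
Proof.
move=> [p [q [a [c [pa qc fpq]]]]] [p' [q' [a' [c' [pa' qc' fpq']]]]].
exists (p * p'), (q * q'), (a.+1 * a'.+1).-1, (c.+1 * c'.+1).-1.
by rewrite !mevalM pa qc pa' qc' -!natrM !rmorphM /= mulrACA fpq fpq'.
Qed.

Lemma semiposM f g : semipos f -> semipos g -> semipos (f * g).
Proof.
move=> [p [q [a [c [pa qc fpq]]]]] [p' [q' [a' [c' [pa' qc' fpq']]]]].
exists (p * p'), (q * q'), (a * a')%N, (c.+1 * c'.+1).-1.
by rewrite !mevalM pa qc pa' qc' -!natrM !rmorphM /= mulrACA fpq fpq'.
Qed.

Lemma posD f g : pos f -> semipos g -> pos (f + g).
Proof.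
move=> [p [q [a [c [pa qc fpq]]]]] [p' [q' [a' [c' [pa' qc' fpq']]]]].
exists (p * q' + p' * q), (q * q'), (a.+1 * c'.+1 + a' * c.+1).-1, (c.+1 * c'.+1).-1.
split.
- by rewrite mevalD !mevalM pa qc pa' qc' -!natrM -natrD; congr (_%:R); lia.
- by rewrite mevalM qc qc' -natrM.
- by rewrite rmorphD !rmorphM /= -fpq -fpq'; ring.
Qed.

Lemma pos_exp f (k : int) : pos f -> pos (f ^ k).
Proof.
move=> fp; have posX (i : nat) : pos (f ^+ i).
  by elim: i => [|i IHi]; [exact: pos1 | rewrite exprS; exact: posM].
by case: k => k; [exact: posX | rewrite NegzE -exprnN; apply/posV/posX].
Qed.

Lemma semipos_exp f (i : nat) : semipos f -> semipos (f ^+ i).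
Proof.
by move=> fp; elim: i => [|i IHi]; [exact/pos_semipos/pos1 | rewrite exprS; exact: semiposM].
Qed.

Lemma pos_mono (x : 'I_N -> F) e : (forall i, e i != 0 -> pos (x i)) -> pos (mono x e).
Proof.
move=> xp; apply: big_ind => [||i _]; [exact: pos1 | exact: posM |].
by have [->|/xp] := eqVneq (e i) 0; [exact: pos1 | exact: pos_exp].
Qed.

Lemma semipos_mono (x : 'I_N -> F) e :
  (forall i, 0 <= e i) -> (forall i, semipos (x i)) -> semipos (mono x e).
Proof.
move=> e0 xp; apply: big_ind => [||i _]; [exact/pos_semipos/pos1 | exact: semiposM |].
by case: (e i) (e0 i) => // k _; exact: semipos_exp.
Qed.

Hypothesis delta_uniq : forall i j, ~~ delta i -> ~~ delta j -> i = j.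

(** At most one variable may fail to be positive, and it has a non-zero exponent in at most one of
    the two monomials; the other monomial is positive. *)
Lemma pos_binomial (x : 'I_N -> F) b : (forall i, semipos (x i)) ->
  (forall i, delta i -> pos (x i)) -> pos (binomial x b).
Proof.
move=> xs xp; have [i di|alldelta] := pickP (fun i => ~~ delta i); last first.
  have xpos i : pos (x i) by apply: xp; have := alldelta i; move/negbFE.
  by apply: posD; [apply: pos_mono | apply/pos_semipos/pos_mono].
wlog bi : b / 0 <= b i => [IH|].
  have [bi|bi] := leP 0 (b i); first exact: IH.
  by rewrite -binomialN; apply: IH; rewrite oppr_ge0 ltW.
rewrite /binomial addrC; apply: posD.
  apply: pos_mono => j bj; apply: xp; apply: contraNT bj => dj.
  by rewrite (delta_uniq dj di); lia.
by apply: semipos_mono => // j; lia.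
Qed.

Lemma pos_var i : delta i -> pos (y i).
Proof.
move=> di; exists 'X_i, 1, 0%N, 0%N; rewrite mevalXU di meval1; split=> //.
by rewrite rmorph1 mulr1 mmapX mmap1U.
Qed.

Lemma semipos_var i : semipos (y i).
Proof.
exists 'X_i, 1, (delta i : nat), 0%N; rewrite mevalXU meval1; split=> //.
by rewrite rmorph1 mulr1 mmapX mmap1U.
Qed.

Lemma meval_Xm (e : 'X_{1..N}) : (forall i, e i != 0%N -> delta i) ->
  at_delta 'X_[e] = 1.
Proof.
move=> ed; rewrite mevalX big1// => i _.
by have [->|/ed ->] := eqVneq (e i) 0%N; rewrite ?expr1n.
Qed.

Lemma meval_Xm0 (e : 'X_{1..N}) i : e i != 0%N -> ~~ delta i -> at_delta 'X_[e] = 0.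
Proof.
move=> ei /negPf di; rewrite mevalX (bigD1 i)//= di expr0n (negPf ei) mul0r//.
Qed.

End Positivity.

(** Remove the variables one by one: by transcendence the numerator of the constant v is v X^M, so v
    is a coefficient of a polynomial over the smaller ring. *)
Lemma lau_int_const (K : idomainType) (F : fieldType) (iota : {rmorphism K -> F})
    (N : nat) (y : 'I_N -> F) (J : {set 'I_N}) (v : K) :
    alg_independent iota y -> iota v \in lau (intr : {rmorphism int -> F}) y J ->
  exists c : int, v = c%:~R.
Proof.
move=> yi; elim: {J}#|J| {-2}J (erefl #|J|) => [|n IHn] J cardJ vJ.
  have J0 : J = set0 by apply/eqP; rewrite -cards_eq0 cardJ.
  move: vJ; rewrite J0 => /lau_set0[c vc]; exists c; apply: (iota_inj yi).
  by rewrite vc rmorph_int.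
have /set0Pn[j jJ] : J != set0 by rewrite -cards_eq0 cardJ.
apply: (IHn (J :\ j)); first by have := cardsD1 j J; rewrite jJ cardJ add1n => -[].
have [M [p [pS vp]]] := lau_peel (alg_independent_neq0 yi j) vJ.
have sub : {subset lau (intr : {rmorphism int -> F}) y (J :\ j) <= lau iota y (J :\ j)}.
  apply: lau_min => [c|i|i]; [exact: rpred_int | exact: lau_var | exact: lau_varV].
suff pE : p = iota v *: 'X^M.
  by have /polyOverP/(_ M) := pS; rewrite pE coefZ coefXn eqxx mulr1.
apply: (transcendental_inj (@lau_transcendental_setD1 _ _ _ _ _ yi J j)).
- by apply/polyOverP => i; exact/sub/(polyOverP pS).
- by rewrite polyOverZ ?rpredX ?polyOverX// lau_iota.
by rewrite hornerZ hornerXn -vp.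
Qed.

(** * Identifying cluster variables *)

Section ClusterVariables.
Variables (K : idomainType) (F : fieldType) (iota : {rmorphism K -> F}).
Hypothesis K0 : [pchar K] =i pred0.
Variables (N n : nat) (mu : 'I_n -> 'I_N).
Hypothesis mu_inj : injective mu.
Variables (y : Tn n -> 'I_N -> F) (B : Tn n -> 'I_N -> 'I_n -> int).
Hypothesis y_edge : forall k t t', Tn_edge k t t' ->
  y t' = mutate_vars mu k (B t) (y t).
Hypothesis B_edge : forall k t t', Tn_edge k t t' ->
  B t' = mutate_matrix mu k (B t).
Hypothesis y_indep : forall t, alg_independent iota (y t).
Hypothesis B_skew : forall t, sign_skew mu (B t).
Hypothesis B_full : forall t, full_columns (B t).
Implicit Types t : Tn n.

Local Notation L t := (lau iota (y t) setT).

(** Exchange relations are subtraction-free and divide only by cluster variables, which stay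
    positive since [delta] is 1 at all mutable indices. *)
Lemma cluster_variable_pos (delta : 'I_N -> bool) t0 t i :
    (forall k, delta (mu k)) ->
    (forall i j, ~~ delta i -> ~~ delta j -> i = j) -> delta i ->
  pos iota (y t0) delta (y t i).
Proof.
move=> dmu duniq di.
suff [_] : (forall i, semipos iota (y t0) delta (y t i)) /\
    (forall i, delta i -> pos iota (y t0) delta (y t i)) by apply.
move: t; apply: (@Tn_ind _ _ t0) => [|k t t' tt' [ys yp]].
  by split=> [j|j dj]; [exact: semipos_var | exact: pos_var].
have yk' : pos iota (y t0) delta (y t' (mu k)).
  rewrite (y_edge tt') mutate_vars_eq; apply: posM.
    by apply: (posV K0 (@y_indep t0)); exact: yp.
  exact: pos_binomial.
split=> j; have [->|jk] := eqVneq j (mu k).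
- exact: pos_semipos.
- by rewrite (edge_neq y_edge tt').
- by [].
- by rewrite (edge_neq y_edge tt'); [exact: yp | ].
Qed.

Lemma cluster_variable_eq t t0 i k :
    (forall t', y t (mu i) / y t0 (mu k) \in L t') ->
  y t (mu i) = y t0 (mu k).
Proof.
move=> div; have [u [v [e [uv aE emu]]]] :=
  divisor_of_cluster_variable mu_inj y_edge B_edge y_indep B_skew B_full div.
pose e' j : int := e j - (j == mu i)%:Z.
have e'mu l : e' (mu l) = 0.
  by rewrite /e' emu (inj_eq mu_inj) subrr.
have y0 t' j : y t' j != 0 by exact: (alg_independent_neq0 (@y_indep t')).
have aE' : y t0 (mu k) = iota u * (y t (mu i) * mono (y t0) e').
  rewrite aE; congr (_ * _).
  have -> : mono (y t0) e' = mono (y t) e'.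
    apply: mono_eq => j ej; apply: (frozen_eq y_edge) => l.
    by apply: contraNneq ej => ->; rewrite e'mu.
  by rewrite -[y t (mu i)](mono_delta (y t)) -monoD//; apply: eq_mono => j; rewrite /e'; lia.
pose m1 := [multinom absz (Num.max (e' j) 0)%R | j < N].
pose m2 := [multinom absz (Num.max (- e' j) 0)%R | j < N].
(* The identity a = u z y^e' with denominators cleared, evaluated at [delta], where z is a quotient
   of positive integers. *)
have main (delta : 'I_N -> bool) : (forall k, delta (mu k)) ->
    (forall i j, ~~ delta i -> ~~ delta j -> i = j) -> exists a c,
    c.+1%:R * meval (fun i => (delta i)%:R : K) 'X_[m2] =
    u * meval (fun i => (delta i)%:R : K) 'X_[m1] * a.+1%:R.
  move=> dmu duniq.
  have [p [q [a [c [pa qc zpq]]]]] := cluster_variable_pos t0 t dmu duniq (dmu i).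
  exists a, c.
  have E : mmap iota (y t0) ('X_(mu k) * 'X_[m2] * q) =
           mmap iota (y t0) ((u *: 'X_[m1]) * p).
    rewrite !rmorphM /= mmapX mmap1U mmapZ !mono_ev -zpq aE'.
    have -> : mono (y t0) (fun j => (m1 j)%:Z) =
        mono (y t0) e' * mono (y t0) (fun j => (m2 j)%:Z).
      by rewrite -monoD//; apply: eq_mono => j; rewrite !mnmE; lia.
    ring.
  have /(congr1 (meval (fun i => (delta i)%:R : K))) := alg_independent_inj (@y_indep t0) E.
  rewrite !mevalM mevalXU dmu mul1r mevalZ pa qc => <-.
  by rewrite mulrC.
have e'0 j : e' j = 0.
  have [[l ->]|jmu] := pselect (exists l, j = mu l); first exact: e'mu.
  pose delta i0 := i0 != j.
  have [l|i1 i2|a [c E]] := main delta.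
  - by apply/eqP => jl; apply: jmu; exists l.
  - by rewrite !negbK => /eqP -> /eqP.
  have dj : ~~ delta j by rewrite negbK.
  have u0 : u != 0 by apply: contra_eq_neq uv => ->; rewrite mul0r eq_sym oner_neq0.
  have [ej|ej|//] := ltrgtP (e' j) 0.
    have m2j : m2 j != 0%N by rewrite mnmE; lia.
    move: E; rewrite (meval_Xm0 _ m2j dj) meval_Xm => [|j' m1j'].
      by rewrite mulr0 mulr1 => /esym/eqP; rewrite mulf_eq0 (negPf u0) (negPf (char0_natS_neq0 K0 a)).
    by apply: contraNneq m1j' => ->; rewrite mnmE; apply/eqP; lia.
  have m1j : m1 j != 0%N by rewrite mnmE; lia.
  move: E; rewrite (meval_Xm0 _ m1j dj) meval_Xm => [|j' m2j'].
    by rewrite mulr0 mul0r mulr1 => /eqP; rewrite (negPf (char0_natS_neq0 K0 c)).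
  by apply: contraNneq m2j' => ->; rewrite mnmE; apply/eqP; lia.
have aE1 : y t0 (mu k) = iota u * y t (mu i).
  rewrite aE' -[X in _ * (_ * X)](_ : 1 = _) ?mulr1//.
  by rewrite -(mono0 (y t0)); apply: eq_mono => j; rewrite e'0.
have zE1 : y t (mu i) = iota v * y t0 (mu k).
  by rewrite aE1 mulrA -rmorphM mulrC [v * u]mulrC uv rmorph1 mulr1.
have y_indepZ t' : alg_independent (intr : {rmorphism int -> F}) (y t').
  exact: alg_independent_int K0 (@y_indep t').
(* The ratio w is a constant and, by the Laurent phenomenon over the integers, a Laurent polynomial
   with integer coefficients. *)
have integral (w : K) t1 t2 i1 i2 : y t1 (mu i1) = iota w * y t2 (mu i2) ->
    exists c : int, w = c%:~R.
  move=> E; apply: (lau_int_const (J := setT) (@y_indep t2)).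
  have -> : iota w = y t1 (mu i1) * (y t2 (mu i2))^-1 by rewrite E mulfK.
  rewrite rpredM ?lau_varV//.
  exact: (laurent_phenomenon mu_inj y_edge B_edge y_indepZ B_skew B_full).
have [c uc] := integral _ _ _ _ _ aE1.
have [d vd] := integral _ _ _ _ _ zE1.
have cd : c * d = 1.
  have : (c * d - 1)%:~R = 0 :> K by rewrite intrB intrM -uc -vd uv subrr.
  move=> cd0; apply/eqP; rewrite -subr_eq0; apply/eqP; move: cd0.
  case: (c * d - 1) => [[//|s]|s].
    by rewrite -pmulrn => /eqP; rewrite (negPf (char0_natS_neq0 K0 s)).
  by rewrite NegzE mulrNz -pmulrn => /eqP; rewrite oppr_eq0 (negPf (char0_natS_neq0 K0 s)).
have [c1|c1] : c = 1 \/ c = -1.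
  by have /eqP := congr1 absz cd; rewrite abszM muln_eq1 => /andP[/eqP c1 _]; lia.
  by rewrite aE1 uc c1 rmorph1 mul1r.
(* At the point with all coordinates 1, u = -1 would equate a positive and a negative integer. *)
have [//|//|a [b]] := main (fun=> true).
rewrite !meval_Xm// !mulr1 uc c1 mulrN1z mulN1r => /eqP.
by rewrite -subr_eq0 opprK -natrD addSn (negPf (char0_natS_neq0 K0 _)).
Qed.

End ClusterVariables.

(** * Primality of the binomial of a primitive vector *)

Section PrimeBinomial.
Variables (K : idomainType) (F : fieldType) (iota : {rmorphism K -> F}).
Variables (N : nat) (y : 'I_N -> F).
Hypothesis y_indep : alg_independent iota y.
Local Notation L := (lau iota y setT).
Local Notation ev := (mmap iota y).

Let y0 := alg_independent_neq0 y_indep.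

Lemma lau_numerator f : f \in L -> exists p (e : 'X_{1..N}), f * ev 'X_[e] = ev p.
Proof.
move=> /lauP; elim => [c|j _|j _|g h _ [p [e ge]] _ [q [e' he]]|g h _ [p [e ge]] _ [q [e' he]]].
- by exists c%:MP, 0%MM; rewrite mpolyX0 rmorph1 mulr1 mmapC.
- by exists 'X_j, 0%MM; rewrite mpolyX0 rmorph1 mulr1 mmapX mmap1U.
- by exists 1, U_(j)%MM; rewrite mmapX mmap1U mulVf// rmorph1.
- exists (p * 'X_[e'] + q * 'X_[e]), (e + e')%MM.
  by rewrite mpolyXD rmorphD !rmorphM /= -ge -he; ring.
- by exists (p * q), (e + e')%MM; rewrite mpolyXD !rmorphM /= -ge -he mulrACA.
Qed.

Lemma Bezout_big (b : 'I_N -> int) :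
  exists l : 'I_N -> int, \sum_i l i * b i = (\big[gcdn/0%N]_i `|b i|%N)%:Z.
Proof.
apply: (big_ind (fun g : nat => exists l : 'I_N -> int, \sum_i l i * b i = g%:Z)).
- by exists (fun=> 0); rewrite big1// => i _; rewrite mul0r.
- move=> g h [l lg] [l' lh]; have [u [v uv]] := Bezoutz g%:Z h%:Z.
  exists (fun i => u * l i + v * l' i); rewrite -[RHS]uv -lg -lh !mulr_sumr -big_split.
  by apply: eq_bigr => i _; rewrite mulrDl !mulrA.
- move=> j _; exists (fun i => (i == j)%:Z * Num.sg (b j)).
  rewrite (bigD1 j)//= eqxx mul1r big1 ?addr0 => [|i /negPf ->]; last by rewrite !mul0r.
  by rewrite abszE normrEsg.
Qed.

Variables (b l : 'I_N -> int).
Hypothesis lb : \sum_i l i * b i = 1.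

Local Notation Y := (mono y b).

(* The retraction of the Laurent ring onto the classes modulo [1 + y^b]: the
   splitting of the lattice by [l] allows to substitute -1 for [y^b]. *)
Definition retract i : F := (-1) ^ l i * y i * Y ^ (- l i).

Let Y0 : Y != 0. Proof. exact: mono_neq0. Qed.

Let N10 : (-1 : F) != 0. Proof. by rewrite oppr_eq0 oner_eq0. Qed.

Lemma retract_neq0 i : retract i != 0.
Proof. by rewrite !mulf_neq0 ?expfz_neq0. Qed.

Lemma prod_expz (x : F) (I : finType) (e : I -> int) : x != 0 ->
  \prod_i x ^ e i = x ^ (\sum_i e i).
Proof.
move=> x0; symmetry; apply: (big_morph (fun k : int => x ^ k)) => [a c|].
  exact: expfzDr.
exact: expr0z.
Qed.

Lemma mono_retract : mono retract b = -1.
Proof.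
rewrite /mono /retract.
under eq_bigr do rewrite !expfzMl !exprz_exp ?mulNr.
rewrite !big_split /= !prod_expz// lb sumrN lb -/(mono y b) expr1z exprN1.
by rewrite -mulrA mulfV// mulr1.
Qed.

Lemma retract_binomial : binomial retract b = 0.
Proof.
rewrite binomial_factor; last exact: retract_neq0.
by rewrite mono_retract subrr mulr0.
Qed.

(** As Y is -1 modulo 1 + Y, [retract i] is congruent to [y i]; the property [good] is stable under
    sums and products. *)
Lemma retract_mod (p : {mpoly K[N]}) :
  exists2 t, t \in L & ev p - mmap iota retract p = t * (1 + Y).
Proof.
have YL : Y \in L by apply: mono_lau => i _; rewrite inE.
have YVL : Y^-1 \in L by rewrite -monoN; apply: mono_lau => i _; rewrite inE.
have YzL (k : int) : Y ^ k \in L.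
  by rewrite -mono_exp; apply: mono_lau => i _; rewrite inE.
have N1L (k : int) : (-1 : F) ^ k \in L.
  by have [->|->] := expfz_N1 F k; rewrite ?rpredN1 ?rpred1.
have retractL i : retract i \in L by rewrite !rpredM ?lau_var.
pose good (p : {mpoly K[N]}) := mmap iota retract p \in L /\
  exists2 t, t \in L & ev p - mmap iota retract p = t * (1 + Y).
have evL q : ev q \in L.
  apply: rpred_sum => e _; rewrite rpredM ?lau_iota//.
  by apply: rpred_prod => i _; rewrite rpredX// lau_var.
have goodM q r : good q -> good r -> good (q * r).
  move=> [qL [t tL qt]] [rL [s sL rs]]; split; first by rewrite rmorphM rpredM.
  exists (ev q * s + t * mmap iota retract r); first by rewrite rpredD// rpredM.
  rewrite !rmorphM /= mulrDl -[_ * s * _]mulrA -rs mulrAC -qt; ring.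
have goodC c : good c%:MP.
  split; first by rewrite mmapC lau_iota.
  by exists 0; rewrite ?rpred0// !mmapC subrr mul0r.
have goodX i : good 'X_i.
  split; first by rewrite mmapX mmap1U.
  have [t tL tE] := expfz_modN1 (T := L) (l i) YL YVL Y0.
  exists (y i * Y ^ (- l i) * t); first by rewrite !rpredM ?lau_var.
  rewrite !mmapX !mmap1U /retract -[RHS]mulrA.
  have -> : t * (1 + Y) = Y ^ l i - (-1) ^ l i by rewrite tE addrAC subrr add0r.
  rewrite mulrBr -[X in X - _](mulr1 (y i)).
  have <- : Y ^ (- l i) * Y ^ l i = 1 by rewrite -expfzDr// addNr expr0z.
  ring.
have goodD q r : good q -> good r -> good (q + r).
  move=> [qL [t tL qt]] [rL [s sL rs]]; split; first by rewrite mmapD rpredD.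
  exists (t + s); first by rewrite rpredD.
  by rewrite !mmapD mulrDl -qt -rs; ring.
have good1 : good 1 by have := goodC 1; rewrite mpolyC1.
suff [] : good p by [].
elim/mpolyind: p => [|c e p _ _ pgood]; first by rewrite -mpolyC0; exact: goodC.
apply: goodD pgood; rewrite -mul_mpolyC; apply/goodM; first exact: goodC.
rewrite mpolyXE_id; apply: big_ind => [||i _]; [exact: good1 | exact: goodM |].
elim: (e i) => [|k IHk]; first exact: good1.
by rewrite exprS; exact: goodM.
Qed.

(** The retraction kills the binomial and has values in a field, so it kills one of the numerators
    of f and g; by [retract_mod] the binomial divides the corresponding factor. *)
Lemma binomial_prime f g : f \in L -> g \in L ->
    divides_in L (binomial y b) (f * g) ->
  divides_in L (binomial y b) f \/ divides_in L (binomial y b) g.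
Proof.
move=> fL gL [c cL fg].
have [p [e fp]] := lau_numerator fL.
have [q [e' gq]] := lau_numerator gL.
have [r [e'' cr]] := lau_numerator cL.
pose m1 := [multinom absz (Num.max (b j) 0)%R | j < N].
pose m2 := [multinom absz (Num.max (- b j) 0)%R | j < N].
have binE z : mmap iota z ('X_[m1] + 'X_[m2]) = binomial z b.
  rewrite mmapD !mmapX; congr (_ + _); apply: eq_bigr => i _;
    by rewrite mnmE exprnP; congr (_ ^ _); lia.
have E : ev (p * q * 'X_[e'']) = ev (r * ('X_[m1] + 'X_[m2]) * 'X_[e + e']).
  rewrite mpolyXD !rmorphM /= binE -fp -gq -cr.
  have -> : f * ev 'X_[e] * (g * ev 'X_[e']) * ev 'X_[e''] =
    (f * g) * (ev 'X_[e] * ev 'X_[e'] * ev 'X_[e'']) by ring.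
  rewrite fg; ring.
have evX0 (a : 'X_{1..N}) : ev 'X_[a] != 0.
  by rewrite mono_ev; exact: mono_neq0.
have half h p0 a : h * ev 'X_[a] = ev p0 -> mmap iota retract p0 = 0 ->
    divides_in L (binomial y b) h.
  move=> hp p00; apply/(divides_in_binomial y_indep) => [i _|]; first by rewrite inE.
  have [t tL] := retract_mod p0; rewrite p00 subr0 -hp => tE.
  exists (t * (ev 'X_[a])^-1); last by rewrite mulrAC -tE mulfK.
  by rewrite rpredM// mono_ev -monoN; apply: mono_lau => i _; rewrite inE.
have /(congr1 (mmap iota retract)) := alg_independent_inj y_indep E.
rewrite !rmorphM /= binE retract_binomial mulr0 mul0r => /eqP.
have rX0 : mmap iota retract 'X_[e''] != 0.
  by rewrite mmapX; apply/prodf_neq0 => i _; rewrite expf_neq0// retract_neq0.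
rewrite mulf_eq0 (negPf rX0) orbF mulf_eq0 => /orP[/eqP p0|/eqP q0].
  by left; apply: half fp p0.
by right; apply: half gq q0.
Qed.

End PrimeBinomial.

(** * Valuations *)

Section Valuation.
Variables (K : idomainType) (F : fieldType) (iota : {rmorphism K -> F}).
Hypothesis K0 : [pchar K] =i pred0.
Variables (N n : nat) (mu : 'I_n -> 'I_N).
Hypothesis mu_inj : injective mu.
Variables (y : Tn n -> 'I_N -> F) (B : Tn n -> 'I_N -> 'I_n -> int).
Hypothesis y_edge : forall k t t', Tn_edge k t t' ->
  y t' = mutate_vars mu k (B t) (y t).
Hypothesis B_edge : forall k t t', Tn_edge k t t' ->
  B t' = mutate_matrix mu k (B t).
Hypothesis y_indep : forall t, alg_independent iota (y t).
Hypothesis B_skew : forall t, sign_skew mu (B t).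
Hypothesis B_full : forall t, full_columns (B t).
Implicit Types t : Tn n.

Local Notation L t := (lau iota (y t) setT).
Local Notation in_upper f := (forall t, f \in L t).

Variables (t0 : Tn n) (k : 'I_n).
Hypothesis Bk_primitive : \big[gcdn/0%N]_i `|B t0 i k|%N = 1%N.
Local Notation a := (y t0 (mu k)).

Let y0 t i : y t i != 0.
Proof. exact: (alg_independent_neq0 (@y_indep t)). Qed.

(** Only the n + 1 Laurent rings around [t0] have to be tested; direction k is kept apart because it
    is the one where A_k changes. *)
Lemma starfish t1 f : Tn_edge k t0 t1 -> f \in L t0 -> f \in L t1 ->
    (forall l t, l != k -> Tn_edge l t0 t -> f \in L t) ->
  in_upper f.
Proof.
move=> e1 f0 f1 fl t.
apply: (upper_bound_mem mu_inj y_edge B_edge y_indep B_skew B_full (t := t0)).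
split=> // l t'; have [->|lk] := eqVneq l k; last exact: fl.
by move=> e'; rewrite (y_edge e') -(y_edge e1).
Qed.

(** At [t0] and at its neighbours in the other directions, a is still a variable and hence a
    unit. *)
Lemma div_upper t1 f : Tn_edge k t0 t1 -> in_upper f -> f / a \in L t1 ->
  in_upper (f / a).
Proof.
move=> e1 fU fa; apply: (starfish e1) => // [|l t lk e].
  by apply: rpredM; [exact: fU | exact: lau_varV].
apply: rpredM; first exact: fU.
by rewrite -(edge_neq y_edge e) ?lau_varV// (inj_eq mu_inj) eq_sym.
Qed.

Lemma div_divides t1 f : Tn_edge k t0 t1 ->
  f / a \in L t1 <-> divides_in (L t1) (binomial (y t1) (B t0 ^~ k)) f.
Proof.
move=> e1; have aE : a = binomial (y t1) (B t0 ^~ k) * (y t1 (mu k))^-1.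
  by rewrite (edge_exchange y_edge y_indep e1) (edge_binomial y_edge B_skew e1).
have P0 : binomial (y t1) (B t0 ^~ k) != 0.
  by have := y0 t0 (mu k); rewrite aE mulf_eq0 negb_or => /andP[].
rewrite aE; split=> [fa|[c cL ->]].
  exists (f / (binomial (y t1) (B t0 ^~ k) / y t1 (mu k)) * (y t1 (mu k))^-1).
    by rewrite rpredM ?lau_varV.
  by rewrite invf_div; move: (y0 t1 (mu k)) P0 => x0 P0; field; rewrite x0 P0.
rewrite invf_div -mulrA [_ * (_ / _)]mulrCA mulfV// mulr1.
by rewrite rpredM ?lau_var.
Qed.

(** If the prime binomial divides the product, it divides a factor, which [cluster_variable_eq]
    identifies with a; for the empty product it would be a unit. *)
Lemma cluster_monomial_not_div t1 (s : seq F) : Tn_edge k t0 t1 ->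
    (forall f, f \in s -> exists t i, f = y t (mu i)) ->
    (forall f, f \in s -> f <> a) ->
  (\prod_(f <- s) f) / a \notin L t1.
Proof.
move=> e1 sC sa; apply/negP => /(div_divides _ e1).
have var_upper t i : in_upper (y t i).
  by move=> t'; exact: (laurent_phenomenon mu_inj y_edge B_edge y_indep B_skew B_full).
have [l lb] := Bezout_big (B t0 ^~ k); rewrite Bk_primitive in lb.
elim: s sC sa => [|f s IHs] sC sa.
  rewrite big_nil => -[c cL c1].
  have [j bj] := full_columns_neq0 k (@B_full t0).
  have /negP := binomial_not_unit y_indep t1 (b := B t0 ^~ k) bj; apply.
  have P0 : binomial (y t1) (B t0 ^~ k) != 0.
    by apply: contra_eq_neq c1 => ->; rewrite mulr0 oner_neq0.
  by rewrite -[_^-1]mul1r c1 mulfK.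
have [t [i fE]] := sC f (mem_head _ _).
rewrite big_cons => fs.
have fL : f \in L t1 by rewrite fE; exact: var_upper.
have sL : \prod_(g <- s) g \in L t1.
  rewrite big_seq; apply: rpred_prod => g gs.
  by have [|t' [i' ->]] := sC g _; [rewrite inE gs orbT | exact: var_upper].
have [fd|] := binomial_prime (@y_indep t1) lb fL sL fs; last first.
  by apply: IHs => g gs; [apply: sC | apply: sa]; rewrite inE gs orbT.
apply: (sa f (mem_head _ _)); rewrite fE.
apply: (cluster_variable_eq K0 mu_inj y_edge B_edge y_indep B_skew B_full).
apply: (div_upper e1); first exact: var_upper.
by apply/(div_divides _ e1); rewrite -fE.
Qed.

Variable M : F.
Hypothesis M_upper : in_upper M.
Hypothesis M_not_div : forall t1, Tn_edge k t0 t1 -> M / a \notin L t1.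

Let aL t : a \in L t.
Proof. exact: (laurent_phenomenon mu_inj y_edge B_edge y_indep B_skew B_full). Qed.

Lemma div_upper_eq0 s : in_upper (M / a ^+ s) -> s = 0%N.
Proof.
have [t1 e1] := Tn_neighbor k t0.
case: s => // s sU; have /negP := M_not_div e1; case.
have -> : M / a = M / a ^+ s.+1 * a ^+ s.
  by rewrite exprS invfM mulrA mulfVK// expf_neq0.
by apply: rpredM; [exact: sU | exact/rpredX/aL].
Qed.

(** Write g = M r a^(e_k), where r is a monomial in the other variables. It is a unit at [t1], so a
    does not divide M r there, and e_k is the exact power of a in g. *)
Lemma valuation_numerator (g : F) (e : 'I_N -> int) :
    in_upper g -> g = M * mono (y t0) e ->
  exists s : nat, [/\ e (mu k) = s, in_upper (g / a ^+ s) &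
    forall s', in_upper (g / a ^+ s') -> (s' <= s)%N].
Proof.
move=> gU gE; have [t1 e1] := Tn_neighbor k t0.
pose r := mono (y t0) (fun i => if i == mu k then 0 else e i).
have r1 : r = mono (y t1) (fun i => if i == mu k then 0 else e i).
  apply: mono_eq => i; case: ifP => [_ /eqP//|/negbT ik _].
  by rewrite (edge_neq y_edge e1).
have r0 : r != 0 by exact: mono_neq0.
have a0 : a != 0 by exact: y0.
have rL1 : r \in L t1 by rewrite r1; apply: mono_lau => i _; rewrite inE.
have rVL1 : r^-1 \in L t1.
  by rewrite r1 -monoN; apply: mono_lau => i _; rewrite inE.
have gr : g = M * r * a ^ e (mu k).
  by rewrite gE (mono_split (mu k)) -/r mulrCA mulrC.
have not_div : M * r / a \notin L t1.
  apply/negP => Mra; have /negP := M_not_div e1; apply.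
  have -> : M / a = M * r / a * r^-1 by field; rewrite r0 a0.
  exact: rpredM.
(* An exponent -(s+1) would put M r / a = g a^s into the Laurent ring at [t1]. *)
case ek: (e (mu k)) gr => [s|s]; last first.
  rewrite NegzE -exprnN => gr; exfalso; have /negP := not_div; apply.
  have -> : M * r / a = g * a ^+ s.
    have as0 : a ^+ s != 0 by rewrite expf_neq0.
    by rewrite gr exprS; field; rewrite a0 as0.
  by apply: rpredM; [exact: gU | exact/rpredX/aL].
rewrite -exprnP => gr; have gs : g / a ^+ s = M * r by rewrite gr mulfK// expf_neq0.
exists s; split=> [//|t|s' s'U].
  rewrite gs; move: t; apply: (starfish e1) => [||l t lk el].
  - by apply: rpredM; [exact: M_upper | apply: mono_lau => i _; rewrite inE].
  - by apply: rpredM; [exact: M_upper | exact: rL1].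
  rewrite -gs -exprVn; apply: rpredM; first exact: gU.
  by rewrite rpredX// -(edge_neq y_edge el) ?lau_varV// (inj_eq mu_inj) eq_sym.
rewrite leqNgt; apply/negP => ss'; have /negP := not_div; apply.
have -> : M * r / a = g / a ^+ s' * a ^+ (s' - s.+1).
  rewrite -{1}(subnKC ss') exprD exprS invfM [(a * _)^-1]invfM gr.
  have b0 : a ^+ s != 0 by rewrite expf_neq0.
  have c0 : a ^+ (s' - s.+1) != 0 by rewrite expf_neq0.
  by field; rewrite a0 b0 c0.
by apply: rpredM; [exact: s'U | exact/rpredX/aL].
Qed.

End Valuation.

(** Dividing by a variable lowers the size, so the process stops; this provides numerators prime to
    all initial variables. *)
Lemma strip_variables (R : idomainType) (n : nat) (p : {mpoly R[n]}) : p != 0 ->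
  exists q (e : 'X_{1..n}), p = q * 'X_[e] /\ forall j, ~ exists r, q = r * 'X_j.
Proof.
elim/ltn_ind: {p}(msize p) {-2}p (erefl (msize p)) => s IHs p ps p0.
have [[j [r pr]]|nodiv] := pselect (exists j r, p = r * 'X_j); last first.
  exists p, 0%MM; rewrite mpolyX0 mulr1; split=> // j [r pr].
  by apply: nodiv; exists j, r.
have r0 : r != 0 by apply: contraNneq p0 => r0; rewrite pr r0 mul0r.
have Xj0 : 'X_j != 0 :> {mpoly R[n]} by rewrite -msupp_eq0 msuppX.
have rs : (msize r < s)%N.
  rewrite -ps pr msizeM// msizeX mdeg1 addn2 /=; exact: ltnSn.
have [q [e [rE qj]]] := IHs _ rs r erefl r0.
by exists q, (e + U_(j))%MM; split=> //; rewrite pr rE mpolyXD mulrA.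
Qed.

(** * Full rank primitive seed patterns and their cluster monomials *)

Section Frozen.
Variables (K : idomainType) (m n : nat).
Local Notation F := (ambient K m n).
Local Notation iota := (coeff_embed K m n).

Lemma full_rank_columns (s : labeled_triple K m n) :
  full_rank s -> full_columns (ext_mat s).
Proof.
move=> /eqP s_full x Bx j.
pose E := map_mx intr (extended_exchange_matrix s) : 'M[rat]_(n + m, n).
have Efree : row_free E^T by rewrite /row_free mxrank_tr.
pose u : 'rV[rat]_n := \row_j (x j)%:~R.
have : u *m E^T = 0.
  apply/rowP => i; rewrite [LHS]mxE [RHS]mxE.
  transitivity ((\sum_j ext_mat s i j * x j)%:~R : rat); last by rewrite Bx.
  rewrite rmorph_sum; apply: eq_bigr => l _ /=.
  by rewrite [E^T _ _]mxE [E _ _]mxE [u _ _]mxE intrM mulrC.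
move/eqP; rewrite mulmx_free_eq0// => /eqP/rowP/(_ j); rewrite !mxE => /eqP.
by rewrite intr_eq0 => /eqP.
Qed.

Lemma skew_symmetrizable_sign (s : labeled_triple K m n) :
  skew_symmetrizable (exB s) -> sign_skew (@lshift n m) (ext_mat s).
Proof.
move=> [d [d0 /matrixP skew]] k l; rewrite !ext_matl.
have := skew l k; rewrite mxE [in RHS]mxE !mul_diag_mx !mxE.
move: (d0 k) (d0 l); move: (d 0 k : int) (d 0 l : int) (exB s k l : int) (exB s l k : int).
move=> a b c e a0 b0 E; apply/idP/idP => h; nia.
Qed.

Variable Sigma : Tn n -> labeled_triple K m n.
Hypothesis Sigma_pattern : seed_pattern Sigma.
Hypothesis K_char0 : [pchar K] =i pred0.
Variable t0 : Tn n.
Hypothesis t0_full_rank : full_rank (Sigma t0).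
Hypothesis t0_primitive : primitive (Sigma t0).

Local Notation y t := (ext_vars (Sigma t)).
Local Notation B t := (ext_mat (Sigma t)).
Local Notation mu := (@lshift n m).
Local Notation L t := (lau iota (y t) setT).

Let mu_inj : injective mu. Proof. exact: lshift_inj. Qed.

Let y_edge k t t' : Tn_edge k t t' -> y t' = mutate_vars mu k (B t) (y t).
Proof. by move=> /(Sigma_pattern.2) ->; exact: ext_vars_mutation. Qed.

Let B_edge k t t' : Tn_edge k t t' -> B t' = mutate_matrix mu k (B t).
Proof. by move=> /(Sigma_pattern.2) ->; exact: ext_mat_mutation. Qed.

Let y_indep t : alg_independent iota (y t).
Proof. by apply: ext_alg_independent; have [] := Sigma_pattern.1 t. Qed.

Let B_skew t : sign_skew mu (B t).
Proof. by apply: skew_symmetrizable_sign; have [] := Sigma_pattern.1 t. Qed.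

Let B_full t : full_columns (B t).
Proof.
move: t; apply: (@Tn_ind _ _ t0); first exact: full_rank_columns.
move=> k t t' e Bt; rewrite (B_edge e); apply: full_columns_mutate Bt.
exact: (sign_skew_diag k (@B_skew t)).
Qed.

Let A0 t j : exA (Sigma t) j != 0.
Proof. by rewrite -ext_varsl; exact: (alg_independent_neq0 (@y_indep t)). Qed.

Lemma upper_cluster_algebraP f :
  upper_cluster_algebra Sigma f <-> forall t, f \in L t.
Proof. by split=> fU t; have := fU t; move/(laurent_ringP (@y_indep t)). Qed.

Lemma cluster_variable_upper t j t' : exA (Sigma t) j \in L t'.
Proof.
rewrite -ext_varsl.
exact: (laurent_phenomenon mu_inj y_edge B_edge y_indep B_skew B_full).
Qed.

Lemma peval_upper p t : peval (exA (Sigma t0)) p \in L t.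
Proof.
apply: rpred_sum => e _; apply: rpredM; first exact: (scalar_lau (@y_indep t)).
by apply: rpred_prod => i _; apply/rpredX/cluster_variable_upper.
Qed.

(** [expansion] is a choice, so its specification follows from the existence of an expansion,
    obtained by moving the monomial factor of a numerator into the denominator. *)
Lemma expansion_spec f : f \in L t0 -> f != 0 ->
  is_expansion (exA (Sigma t0)) f (expansion (exA (Sigma t0)) f).
Proof.
move=> /(laurent_ringP (@y_indep t0))[p [e fE]] f0; apply: xgetPex.
have p0 : p != 0.
  by apply: contraNneq f0 => p0; rewrite fE p0 /peval mmap0 mul0r.
have [q [e' [pE qj]]] := strip_variables p0.
exists (\col_i ((e i)%:Z - (e' i)%:Z), q); split=> //=.
rewrite fE pE pevalM peval_Xn -mulrA; congr (_ * _).
rewrite -!prodfV -big_split; apply: eq_bigr => i _ /=.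
by rewrite mxE expfzDr// -exprnP -exprnN invfM invrK mulrC.
Qed.

Lemma valuation_pairing_eq a f s : upper_cluster_algebra Sigma (f / a ^+ s) ->
    (forall s', upper_cluster_algebra Sigma (f / a ^+ s') -> (s' <= s)%N) ->
  valuation_pairing Sigma a f = Some s.
Proof.
move=> fs smax; apply: xget_unique; first by exists s.
move=> _ [s' [-> fs' s'max]]; congr Some.
by apply/eqP; rewrite eqn_leq smax// s'max.
Qed.

Section Monomial.
Variable s : seq F.
Hypothesis s_var : forall f, f \in s -> cluster_variable Sigma f.
Local Notation M := (\prod_(f <- s) f).
Local Notation A := (exA (Sigma t0)).

Lemma monomial_upper t : M \in L t.
Proof.
rewrite big_seq; apply: rpred_prod => f /s_var[t' [j ->]].
exact: cluster_variable_upper.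
Qed.

Lemma monomial_neq0 : M != 0.
Proof. by rewrite prodf_seq_neq0; apply/allP => f /s_var[t' [j ->]]; exact: A0. Qed.

Lemma monomial_expansion :
  M = peval A (numerator A M) / \prod_i A i ^ d_vector A M i 0.
Proof. by have [] := expansion_spec (monomial_upper t0) monomial_neq0. Qed.

Lemma monomial_valuations k : (forall f, f \in s -> f <> A k) ->
  [/\ valuation_pairing Sigma (A k) M = Some 0%N,
      omap Posz (valuation_pairing Sigma (A k) (peval A (numerator A M)))
        = Some (d_vector A M k 0) &
      0 <= d_vector A M k 0].
Proof.
move=> sk; have kE : y t0 (mu k) = A k by exact: ext_varsl.
have not_div t1 : Tn_edge k t0 t1 -> M / y t0 (mu k) \notin L t1.
  move=> e1; apply: (cluster_monomial_not_div K_char0 mu_inj y_edge B_edge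
    y_indep B_skew B_full (@t0_primitive k) e1) => f fs; last by rewrite kE; exact: sk.
  by have [t [j ->]] := s_var fs; exists t, j; rewrite ext_varsl.
pose e (i : 'I_(n + m)) : int :=
  match split i with inl j => d_vector A M j 0 | inr _ => 0 end.
have ek : e (mu k) = d_vector A M k 0 by rewrite /e split_lshift.
have gE : peval A (numerator A M) = M * mono (y t0) e.
  have -> : mono (y t0) e = \prod_i A i ^ d_vector A M i 0.
    rewrite mono_ext [X in _ * X]big1 => [|j _]; last by rewrite /e split_rshift expr0z.
    by rewrite mulr1; apply: eq_bigr => i _; rewrite /e split_lshift.
  rewrite [X in _ = X * _]monomial_expansion mulfVK//.
  by apply/prodf_neq0 => i _; rewrite expfz_neq0.
have [d [ed gd dmax]] := valuation_numerator mu_inj y_edge B_edge y_indep B_skew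
  B_full (t0 := t0) (k := k) monomial_upper not_div (@peval_upper _) gE.
rewrite -ek ed kE in gd dmax *; split=> //.
  apply: valuation_pairing_eq => [|d' /upper_cluster_algebraP Md'].
    by apply/upper_cluster_algebraP => t; rewrite divr1; exact: monomial_upper.
  rewrite leqn0; apply/eqP.
  apply: (div_upper_eq0 mu_inj y_edge B_edge y_indep B_skew B_full (t0 := t0)
    (k := k) not_div); by rewrite kE.
rewrite (valuation_pairing_eq (s := d))//; first exact/upper_cluster_algebraP.
by move=> d' /upper_cluster_algebraP; exact: dmax.
Qed.

End Monomial.
End Frozen.

Theorem proposition5p6 (K : idomainType) (m n : nat)
    (K_ufd : factorial_domain K) (K_char0 : [pchar K] =i pred0)
    (Sigma : Tn n -> labeled_triple K m n)
    (Sigma_pattern : seed_pattern Sigma)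
    (Sigma_binomials : no_invertible_exchange_binomial Sigma)
    (t0 : Tn n)
    (t0_full_rank : full_rank (Sigma t0))
    (t0_primitive : primitive (Sigma t0)) :
  let A := exA (Sigma t0) in
  (forall s : seq (ambient K m n),
     (forall f, f \in s -> cluster_variable Sigma f) ->
     let M := \prod_(f <- s) f in
     forall k : 'I_n,
       (forall f, f \in s -> f <> A k) ->
       [/\ valuation_pairing Sigma (A k) M = Some 0%N,
           d_vector A M k 0 = d_compatibility A k M,
           omap Posz (valuation_pairing Sigma (A k) (peval A (numerator A M)))
             = Some (d_vector A M k 0) &
           0 <= d_vector A M k 0])
  /\
  (forall s s' : seq (ambient K m n),
     (forall f, f \in s ->
        cluster_variable Sigma f /\ forall k, f <> A k) ->
     (forall f, f \in s' ->
        cluster_variable Sigma f /\ forall k, f <> A k) ->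
     let M := \prod_(f <- s) f in
     let M' := \prod_(f <- s') f in
     numerator A M = numerator A M' ->
     d_vector A M = d_vector A M' /\ M = M').
Proof.
move=> A; have valuations s sV k := @monomial_valuations _ _ _ _
  Sigma_pattern K_char0 t0 t0_full_rank t0_primitive s sV k.
split=> [s sV M k sk|s s' sV s'V M M' MM'].
  by have [] := valuations s sV k sk.
have sV1 f : f \in s -> cluster_variable Sigma f by case/sV.
have s'V1 f : f \in s' -> cluster_variable Sigma f by case/s'V.
(* Each component of either d-vector is the valuation of the common numerator polynomial. *)
have dd' : d_vector A M = d_vector A M'.
  apply/colP => k.
  have [_ dM _] := valuations s sV1 k (fun f fs => (sV f fs).2 k).
  have [_ dM' _] := valuations s' s'V1 k (fun f fs => (s'V f fs).2 k).
  by move: dM'; rewrite -/M' -/A -MM' dM => -[].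
split=> //; rewrite /M /M'.
rewrite (monomial_expansion Sigma_pattern t0_full_rank sV1).
rewrite (monomial_expansion Sigma_pattern t0_full_rank s'V1).
by rewrite -/A -/M -/M' MM' dd'.
Qed.
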